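(* Let $\omega\in\Omega^1(\mathbb{C}^n,0)$ be a germ of a holomorphic $1$-form such that the rank of the linear part of $\omega$ is at least $p+1$, where $p$ is a nonnegative integer. Then $\omega$ satisfies the division property by $k$-forms for $k\le p$.
   Context: $\Omega^k(\mathbb{C}^n,0)$ denotes germs at $0$ of holomorphic $k$-forms. $\omega\in\Omega^1(\mathbb{C}^n,0)$ satisfies the division property by $k$-forms if for any $\alpha\in\Omega^k(\mathbb{C}^n,0)$ with $\omega\wedge\alpha=0$ there exists $\beta\in\Omega^{k-1}(\mathbb{C}^n,0)$ such that $\alpha=\omega\wedge\beta$ (for $k=0$, with $\Omega^{-1}=0$, this says that $\omega\wedge\alpha=0$ implies $\alpha=0$). Writing $\omega=\sum_{i=1}^nA_i\,dz_i$ and $X_\omega=\sum_{i=1}^nA_i\,\partial/\partial z_i$, the rank of the linear part of $\omega$ is the rank of the Jacobian matrix $DX_\omega(0)$. *)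

(* Defs.v *)
From HB Require Import structures.
From mathcomp Require Import all_boot all_order all_algebra.
From mathcomp Require Import complex.
From mathcomp Require Import all_classical all_reals all_analysis.

Set Implicit Arguments.
Unset Strict Implicit.
Unset Printing Implicit Defensive.

Import Order.TTheory GRing.Theory Num.Theory.
Import numFieldNormedType.Exports.

Local Open Scope classical_set_scope.
Local Open Scope ring_scope.

Section ExteriorAlgebra.
Variables (C : comNzRingType) (n : nat).

(* The exterior algebra on dz_0, ..., dz_(n-1): a stands for the sum over I of
   a I *: dz_I, where dz_I = dz_{i_1} /\ ... /\ dz_{i_k} for
   I = {i_1 < ... < i_k}. *)
Definition ext := {ffun {set 'I_n} -> C}.

(* For disjoint I and J, dz_I /\ dz_J = shuffle_sign I J *: dz_(I :|: J). *)
Definition shuffle_sign (I J : {set 'I_n}) : C :=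
  (-1) ^+ #|[set ij : 'I_n * 'I_n | [&& ij.1 \in I, ij.2 \in J
                                      & (ij.2 < ij.1)%N]]%SET|.

Definition wedge (a b : ext) : ext :=
  [ffun K : {set 'I_n} => \sum_(I : {set 'I_n} | I \subset K)
     shuffle_sign I (K :\: I) * a I * b (K :\: I)].

End ExteriorAlgebra.

(* R[i] packed as a numClosedFieldType: the library attaches its canonical
   normed-space structures to such an abstract type, not to R[i] itself. *)
Definition complexes (R : realType) : numClosedFieldType := R[i].

Section FormGerms.
Variables (R : realType) (n : nat).
Local Notation C := (complexes R).

(* Germs at 0 are handled through representatives: differential forms are
   total functions on C^n, of which only the restrictions to neighbourhoods
   of 0 matter. *)
Definition diff_form := 'rV[C]_n -> ext C n.

Definition germ_eq (a b : diff_form) : Prop :=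
  \forall z \near (0 : 'rV[C]_n), a z = b z.

Definition form0 : diff_form := fun _ => [ffun=> 0].

Definition wedge_form (a b : diff_form) : diff_form :=
  fun z => wedge (a z) (b z).

(* a represents an element of Omega^k(C^n, 0). The scalars are complex, so
   differentiability is complex differentiability. The degree is an integer in
   order that k = -1 gives the zero space. *)
Definition holomorphic_form (k : int) (a : diff_form) : Prop :=
  \forall z \near (0 : 'rV[C]_n), forall I : {set 'I_n},
    differentiable (fun y => a y I : C) z /\ (#|I|%:Z != k -> a z I = 0).

Definition division_property (w : diff_form) (k : int) : Prop :=
  forall a : diff_form, holomorphic_form k a -> germ_eq (wedge_form w a) form0 ->
  exists2 b : diff_form, holomorphic_form (k - 1) b & germ_eq a (wedge_form w b).

(* X_w, whose i-th component is the coefficient of dz_i in w *)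
Definition dual_field (w : diff_form) : 'rV[C]_n -> 'rV[C]_n :=
  fun z => \row_(i < n) w z [set i]%SET.

(* The library's jacobian acts on row vectors, hence is the transpose of
   DX_w(0). *)
Definition linear_part_rank (w : diff_form) : nat :=
  \rank (jacobian (dual_field w) 0).

End FormGerms.

(* Main.v *)
Require Import Defs.
From HB Require Import structures.
From mathcomp Require Import all_boot all_order all_algebra.
From mathcomp Require Import complex ring lra.
From mathcomp Require Import all_classical all_reals all_analysis.

(** The induction. Write w as the sum of the A_i dz_i, and let a be a k-form
    with w /\ a = 0. Contraction with the l-th coordinate field is an
    antiderivation ([contract_wedge]), so A_l a = w /\ g, where g is the
    contraction of a. If A_l(0) <> 0, it remains to divide by A_l. Otherwise
    take l such that the differential of A_l at 0 is not zero; there is one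
    because the linear part has positive rank. The locus A_l = 0 is then a
    smooth hypersurface, with a holomorphic retraction rho(x) = x - psi(x) e
    onto it ([implicit_function], [retraction]). Composing the coefficients of
    w and g with rho, while keeping the symbols dz_i, preserves the equation
    w /\ g = A_l a = 0 that holds on the hypersurface, and lowers the rank of
    the linear part by at most one ([rank_retract]). By induction on k there
    is b with g o rho = (w o rho) /\ b; hence g - w /\ b vanishes where A_l
    does, so it is A_l d for some holomorphic d ([division]). Since
    w /\ w /\ b = 0, it follows that A_l a = w /\ g = A_l (w /\ d), and A_l can
    be cancelled ([torsion_free]): a = w /\ d. This is the proof that a Koszul
    complex on a regular sequence is exact; as dz_i is never pulled back, the
    number of variables and the exterior algebra stay the same throughout.

    The analysis. A holomorphic function is here a function that is complex
    differentiable at every point near 0, with no continuity of the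
    derivative, so that division needs Cauchy's theory from its beginning:
    Goursat's theorem for rectangles by bisection ([goursat]), Cauchy's
    formula ([cauchy_formula]), where the constant 2 pi i enters only through
    the bound [nv_winding], and the Taylor estimates in one variable, which
    hold with constants independent of the function. They give the strict
    differentiability of A_l along e ([strict_estimate]), and the maximum
    estimate for the inverse of A_l gives the zeros of A_l on lines parallel
    to e ([zero_exists]). The quotient f / A_l is differentiable off the
    hypersurface, and along every line parallel to e by the removable
    singularity theorem ([removable]). That suffices for differentiability in
    all variables ([hartogs_line]): by Cauchy's formula the values of the
    quotient near a point of the hypersurface are means of its values on
    squares that avoid it, and the mean of the differentials there is the
    differential. *)

Set Implicit Arguments.
Unset Strict Implicit.
Unset Printing Implicit Defensive.
Import Order.TTheory GRing.Theory Num.Theory.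
Import numFieldNormedType.Exports.
Local Open Scope classical_set_scope.
Local Open Scope ring_scope.

(** * Real-valued norms, and limits in epsilon-delta form *)

Section Norm.
Variable R : realType.
Local Notation C := (complexes R).
(** The norm of a normed module over C takes values in C, whose order is
    partial; real values make the estimates accessible to real arithmetic. *)
Definition nv (V : normedZmodType C) (v : V) : R := complex.Re `|v|.
Definition inC (x : R) : C := x%:C%C.

Lemma nvE (V : normedZmodType C) (v : V) : `|v| = inC (nv v).
Proof. by symmetry; apply: RRe_real; exact: normr_real. Qed.
Lemma inC_le x y : (inC x <= inC y) = (x <= y). Proof. exact: lecR. Qed.
Lemma inC_lt x y : (inC x < inC y) = (x < y). Proof. exact: ltcR. Qed.
Lemma inCM x y : inC (x * y) = inC x * inC y. Proof. exact: rmorphM. Qed.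
Lemma inCD x y : inC (x + y) = inC x + inC y. Proof. exact: rmorphD. Qed.
Lemma inCV x : inC x^-1 = (inC x)^-1. Proof. exact: fmorphV. Qed.
Lemma inCN x : inC (- x) = - inC x. Proof. exact: rmorphN. Qed.
Lemma inC0 : inC 0 = 0. Proof. by []. Qed.
Lemma inC1 : inC 1 = 1. Proof. by []. Qed.
Lemma inCI : injective inC. Proof. exact: complexI. Qed.
Lemma pos_inC (e : C) : 0 < e -> exists2 r : R, 0 < r & e = inC r.
Proof.
move=> e0; exists (complex.Re e); last by rewrite /inC RRe_real // gtr0_real.
by rewrite -inC_lt /inC RRe_real // gtr0_real.
Qed.

Section V.
Variable V : normedZmodType C.
Implicit Types v w : V.
Lemma nv_ge0 v : 0 <= nv v. Proof. by rewrite -inC_le -nvE inC0 normr_ge0. Qed.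
Lemma nvD v w : nv (v + w) <= nv v + nv w.
Proof. by rewrite -inC_le inCD -!nvE ler_normD. Qed.
Lemma nvN v : nv (- v) = nv v. Proof. by rewrite /nv normrN. Qed.
Lemma nvB v w : nv (v - w) <= nv v + nv w.
Proof. by rewrite -(nvN w) nvD. Qed.
Lemma nvBC v w : nv (v - w) = nv (w - v). Proof. by rewrite /nv distrC. Qed.
Lemma nv0 : nv (0 : V) = 0. Proof. by rewrite /nv normr0. Qed.
Lemma nv_eq0 v : (nv v == 0) = (v == 0).
Proof. by rewrite -(inj_eq inCI) -nvE inC0 normr_eq0. Qed.
Lemma nv_gt0 v : (0 < nv v) = (v != 0).
Proof. by rewrite lt_neqAle nv_ge0 andbT eq_sym nv_eq0. Qed.
End V.
Lemma nvM (x y : C) : nv (x * y) = nv x * nv y.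
Proof. by apply: inCI; rewrite inCM -!nvE normrM. Qed.
Lemma nvV (x : C) : nv x^-1 = (nv x)^-1.
Proof. by apply: inCI; rewrite inCV -!nvE normfV. Qed.
Lemma nv1 : nv (1 : C) = 1. Proof. by rewrite /nv normr1. Qed.
Lemma nv_inC x : nv (inC x) = `|x|.
Proof. by rewrite /nv /inC normc_def /= expr0n addr0 sqrtr_sqr. Qed.
Lemma nvZ (V : normedModType C) (x : C) (v : V) : nv (x *: v) = nv x * nv v.
Proof. by apply: inCI; rewrite inCM -!nvE normrZ. Qed.
Lemma nv_Re (x : C) : `|complex.Re x| <= nv x.
Proof. by rewrite -inC_le -nvE; exact: normc_ge_Re. Qed.

Lemma nearP (V : normedModType C) (x : V) (P : V -> Prop) :
  (\forall z \near x, P z) <-> exists2 d, 0 < d & forall v, nv v < d -> P (x + v).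
Proof.
split=> [/nbhs_normP [e /pos_inC [d d0 ->] H]|[d d0 H]].
  exists d => // v vd; apply: H => /=.
  by rewrite opprD addrA subrr sub0r normrN nvE inC_lt.
apply/nbhs_normP; exists (inC d); first by rewrite /= -inC0 inC_lt.
move=> z /= zd; rewrite -(subrK x z) addrC; apply: H.
by rewrite -inC_lt -nvE distrC.
Qed.

Lemma contP (V W : normedModType C) (f : V -> W) (x : V) :
  {for x, continuous f} <-> forall e, 0 < e -> exists2 d, 0 < d &
     forall v, nv v < d -> nv (f (x + v) - f x) < e.
Proof.
split.
  move=> /cvgrPdist_lt cf e e0; have /cf/nearP [d d0 H] : 0 < inC e by rewrite -inC0 inC_lt.
  by exists d => // v /H; rewrite nvE inC_lt nvBC.
move=> H; apply/cvgrPdist_lt => e /pos_inC[r /H[d d0 {}H] ->]; apply/nearP; exists d => // v /H.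
by rewrite nvE inC_lt nvBC.
Qed.

Lemma diff_eps (V W : normedModType C) (f : V -> W) (x : V) :
  differentiable f x -> forall e, 0 < e -> exists2 d, 0 < d &
     forall v, nv v < d -> nv (f (x + v) - f x - 'd f x v) <= e * nv v.
Proof.
move=> /diff_locallyP [_ /eqaddoP H] e e0.
have /H/nearP[d d0 {}H] : 0 < inC e by rewrite -inC0 inC_lt.
exists d => // v /H; rewrite add0r !nvE -inCM inC_le.
by rewrite !fctE opprD addrA /= [v + x]addrC.
Qed.

Lemma eps_diff (V W : normedModType C) (f : V -> W) (x : V) (L : {linear V -> W}) :
  continuous L -> (forall e, 0 < e -> exists2 d, 0 < d &
     forall v, nv v < d -> nv (f (x + v) - f x - L v) <= e * nv v) ->
  is_diff x f L.
Proof.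
move=> cL H; have oL : f \o shift x = cst (f x) + L +o_ 0 id.
  apply/eqaddoP => e /pos_inC[r /H[d d0 {}H] ->]; apply/nearP; exists d => // v /H.
  by rewrite add0r !nvE -inCM inC_le !fctE opprD addrA /= [v + x]addrC.
apply: DiffDef; last exact: diff_unique.
by apply/diff_locallyP; rewrite (diff_unique cL oL).
Qed.

Section Cont.
Variables (V : normedModType C) (x : V).
Implicit Types f g : V -> C.
Lemma cont_cst (k : C) : {for x, continuous (fun _ : V => k)}.
Proof. exact: cvg_cst. Qed.
Lemma contD f g : {for x, continuous f} -> {for x, continuous g} ->
  {for x, continuous (fun z => f z + g z)}.
Proof. exact: cvgD. Qed.
Lemma contN f : {for x, continuous f} -> {for x, continuous (fun z => - f z)}.
Proof. exact: cvgN. Qed.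
Lemma contM f g : {for x, continuous f} -> {for x, continuous g} ->
  {for x, continuous (fun z => f z * g z)}.
Proof. exact: cvgM. Qed.
Lemma contV f : f x != 0 -> {for x, continuous f} -> {for x, continuous (fun z => (f z)^-1)}.
Proof. exact: cvgV. Qed.
End Cont.
Lemma cont_id (V : normedModType C) (x : V) : {for x, continuous (fun z => z)}.
Proof. exact: cvg_id. Qed.
End Norm.

(** * Integrals of complex functions over real segments *)

Section Cint.
Variable R : realType.
Local Notation C := (complexes R).
Local Notation mu := (@lebesgue_measure R).
Local Notation inC := (@inC R).

(** Real and imaginary parts are integrated separately, which costs a factor 2
    in [cint_norm]; it is absorbed by the constants of the estimates. *)
Definition cint (a b : R) (u : C -> C) : C :=
  Complex (\int[mu]_(t in `[a, b]) complex.Re (u (inC t)))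
          (\int[mu]_(t in `[a, b]) complex.Im (u (inC t))).

Definition seg_cont (a b : R) (u : C -> C) :=
  forall t, a <= t <= b -> {for inC t, continuous u}.

Lemma nv_Im (x : C) : `|complex.Im x| <= nv x.
Proof.
have := nv_Re (x * 'i%C); rewrite (ReiNIm x) normrN nvM => /le_trans -> //.
by rewrite /nv normc_def /= expr0n expr1n add0r sqrtr1 mulr1.
Qed.

Lemma nv_le_ReIm (x : C) : nv x <= `|complex.Re x| + `|complex.Im x|.
Proof.
rewrite {1}(complexE x) (le_trans (nvD _ _)) // nvM !nv_inC.
by rewrite /nv normc_def /= expr0n expr1n add0r sqrtr1 mul1r.
Qed.

Lemma cplxD (a b c d : R) : (Complex a b : C) + Complex c d = Complex (a + c) (b + d).
Proof. by []. Qed.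

Lemma cplxM (a b c d : R) : (Complex a b : C) * Complex c d =
  Complex (a * c - b * d) (a * d + b * c).
Proof. by []. Qed.

Lemma seg_cont_ReIm a b u : seg_cont a b u ->
  {within `[a, b], continuous (fun t => complex.Re (u (inC t)))} /\
  {within `[a, b], continuous (fun t => complex.Im (u (inC t)))}.
Proof.
move=> cu; split; apply: continuous_in_subspaceT => t; rewrite inE /= in_itv /= => /cu /contP H.
all: apply/cvgrPdist_lt => e /H[d d0 {}H]; apply/nbhs_normP; exists d => // s /= sd.
all: have /H : nv (inC (s - t)) < d by rewrite nv_inC distrC.
all: rewrite -inCD [t + _]addrC subrK => /(le_lt_trans _); apply.
  by rewrite -raddfB -normrN -raddfN opprB; exact: nv_Re.
by rewrite -raddfB -normrN -raddfN opprB; exact: nv_Im.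
Qed.

Lemma seg_cont_integrable a b u : seg_cont a b u ->
  mu.-integrable `[a, b] (EFin \o (fun t => complex.Re (u (inC t)))) /\
  mu.-integrable `[a, b] (EFin \o (fun t => complex.Im (u (inC t)))).
Proof.
by case/seg_cont_ReIm => h1 h2; split; apply: continuous_compact_integrable => //;
  exact: segment_compact.
Qed.

Lemma cintD a b u v : seg_cont a b u -> seg_cont a b v ->
  cint a b (fun z => u z + v z) = cint a b u + cint a b v.
Proof.
move=> /seg_cont_integrable[u1 u2] /seg_cont_integrable[v1 v2].
rewrite /cint cplxD -!RintegralD //.
by congr Complex; apply: eq_Rintegral => t _; rewrite raddfD.
Qed.

Lemma eq_cint a b u v : (forall t, a <= t <= b -> u (inC t) = v (inC t)) ->
  cint a b u = cint a b v.
Proof.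
by move=> uv; congr Complex; apply: eq_Rintegral => t; rewrite inE /= in_itv /= => /uv ->.
Qed.

Lemma cintZ a b u (k : C) : seg_cont a b u ->
  cint a b (fun z => k * u z) = k * cint a b u.
Proof.
move=> /seg_cont_integrable[u1 u2]; case: k => x y.
have iZ (f : R -> R) c : mu.-integrable `[a, b] (EFin \o f) ->
    mu.-integrable `[a, b] (EFin \o (fun t => c * f t)).
  by move=> /(integrableZl _ c); apply.
rewrite /cint cplxM -!RintegralZl // -RintegralB ?iZ // -RintegralD ?iZ //.
by congr Complex; apply: eq_Rintegral => t _; case: (u _).
Qed.

Lemma cintN a b u : seg_cont a b u -> cint a b (fun z => - u z) = - cint a b u.
Proof.
move=> cu; rewrite -mulN1r -cintZ //.
by apply: eq_cint => t _; rewrite mulN1r.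
Qed.

Lemma cint_norm a b u M : a <= b -> seg_cont a b u ->
  (forall t, a <= t <= b -> nv (u (inC t)) <= M) ->
  nv (cint a b u) <= 2 * M * (b - a).
Proof.
move=> ab /seg_cont_integrable[u1 u2] uM.
have key (f : R -> R) : mu.-integrable `[a, b] (EFin \o f) ->
   (forall t, a <= t <= b -> `|f t| <= M) -> `|\int[mu]_(t in `[a, b]) f t| <= M * (b - a).
  move=> fi fM; apply: le_trans (le_normr_Rintegral _ _) _ => //.
  have -> : M * (b - a) = \int[mu]_(t in `[a, b]) M.
    rewrite Rintegral_cst //= lebesgue_measure_itv /= lte_fin.
    case: ltP => [_|ba]; first by rewrite -EFinB.
    by have -> : b - a = 0; [lra|rewrite mulr0].
  apply: le_Rintegral => //.
  - exact: integrable_norm.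
  - apply: continuous_compact_integrable; first exact: segment_compact.
    by apply: continuous_subspaceT => ?; exact: cvg_cst.
apply: le_trans (nv_le_ReIm _) _.
have -> : 2 * M * (b - a) = M * (b - a) + M * (b - a) by ring.
apply: lerD; apply: key => // t /uM; apply: le_trans; [exact: nv_Re|exact: nv_Im].
Qed.

Lemma le_Re_cint a b u M : a <= b -> seg_cont a b u ->
  (forall t, a <= t <= b -> M <= complex.Re (u (inC t))) ->
  M * (b - a) <= complex.Re (cint a b u).
Proof.
move=> ab /seg_cont_integrable[u1 _] uM.
have -> : M * (b - a) = \int[mu]_(t in `[a, b]) M.
  rewrite Rintegral_cst //= lebesgue_measure_itv /= lte_fin.
  case: ltP => [_|ba]; first by rewrite -EFinB.
  by have -> : b - a = 0; [lra|rewrite mulr0].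
apply: le_Rintegral => //.
apply: continuous_compact_integrable; first exact: segment_compact.
by apply: continuous_subspaceT => ?; exact: cvg_cst.
Qed.

Lemma cint_cat a m b u : a <= m <= b -> seg_cont a b u ->
  cint a b u = cint a m u + cint m b u.
Proof.
move=> /andP[am mb] /seg_cont_integrable[u1 u2].
have key (f : R -> R) : mu.-integrable `[a, b] (EFin \o f) ->
   \int[mu]_(t in `[a, b]) f t = \int[mu]_(t in `[a, m]) f t + \int[mu]_(t in `[m, b]) f t.
  move=> fi.
  have am' : (BLeft a <= BRight m)%O by rewrite bnd_simp.
  have mb' : (BRight m <= BRight b)%O by rewrite bnd_simp.
  have /eqP := Rintegral_itvB fi am' mb'.
  rewrite subr_eq addrC => /eqP ->; congr (_ + _).
  apply: Rintegral_itv_obnd_cbnd.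
  by apply: integrableS fi => //; apply: subset_itv; rewrite bnd_simp.
by rewrite /cint cplxD -!key.
Qed.

Lemma Rint_shift (f : R -> R) (a b s : R) : a <= b ->
  {within `[a + s, b + s], continuous f} ->
  \int[mu]_(t in `[a + s, b + s]) f t = \int[mu]_(t in `[a, b]) f (t + s).
Proof.
move=> ab cf; congr fine; pose F (t : R) := t + s.
have dF (t : R) : is_derive t (1 : R) F (1 : R).
  rewrite -[X in is_derive _ _ _ X]addr0.
  exact: is_deriveD (is_derive_id _ _) (is_derive_cst _ _ _).
have F1 : F^`()%classic = cst (1 : R) by apply/funext => t; rewrite derive1E derive_val.
have cF (t : R) : {for t, continuous F}.
  by apply/differentiable_continuous/derivable1_diffP; apply: ex_derive.
rewrite (@integration_by_substitution_increasing R F f a b ab) //.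
- by apply: eq_integral => t _; rewrite F1 !fctE mulr1.
- by move=> x y _ _; rewrite /F ltrD2r.
- by rewrite F1 => ? _; exact: cvg_cst.
- by rewrite F1; exact: is_cvg_cst.
- by rewrite F1; exact: is_cvg_cst.
split=> //; last exact: cvg_at_left_filter (cF b).
exact: cvg_at_right_filter (cF a).
Qed.

Lemma cint_shift a b s u : a <= b -> seg_cont (a + s) (b + s) u ->
  cint (a + s) (b + s) u = cint a b (fun z => u (z + inC s)).
Proof.
move=> ab /seg_cont_ReIm[u1 u2]; rewrite /cint !Rint_shift //.
by congr Complex; apply: eq_Rintegral => t _; rewrite inCD.
Qed.

Lemma Rint_id a b : a <= b -> \int[mu]_(t in `[a, b]) t = (b ^+ 2 - a ^+ 2) / 2.
Proof.
rewrite le_eqVlt => /predU1P[->|ab].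
  by rewrite set_itv1 Rintegral_set1 subrr mul0r.
pose F (t : R) := 2^-1 * t ^+ 2.
have dF (t : R) : is_derive t (1 : R) F t.
  by apply: is_derive_eq; rewrite /GRing.scale /=; field.
have cF (t : R) : {for t, continuous F}.
  by apply/differentiable_continuous/derivable1_diffP; apply: ex_derive.
have := @continuous_FTC2 R id F a b ab.
rewrite /Rintegral => -> /=; first by rewrite /F; field.
- by apply: continuous_subspaceT => x; exact: cvg_id.
- split=> //; last exact: cvg_at_left_filter (cF b).
  exact: cvg_at_right_filter (cF a).
- by move=> t _; rewrite derive1E derive_val.
Qed.

Lemma cint_id a b : a <= b -> cint a b id = inC ((b ^+ 2 - a ^+ 2) / 2).
Proof.
move=> ab; rewrite /cint -Rint_id //; congr Complex.
by rewrite Rintegral_cst //= mul0r.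
Qed.

Lemma cint_cst a b k : a <= b -> cint a b (fun=> k) = k * inC (b - a).
Proof.
move=> ab; case: k => x y; rewrite /inC /real_complex_def cplxM !mulr0 subr0 add0r.
by rewrite /cint !Rintegral_cst //= lebesgue_measure_itv /= lte_fin; case: ltP => [_|ba];
  rewrite -?EFinB //=; have -> : b - a = 0; [lra|]; rewrite !mulr0.
Qed.

End Cint.

(** * Integrals along the boundary of a rectangle *)

Section Rect.
Variable R : realType.
Local Notation C := (complexes R).
Local Notation inC := (@inC R).

Definition imag : C := Complex 0 1.
Definition pt (x y : R) : C := inC x + imag * inC y.

Lemma nv_imag : nv imag = 1.
Proof. by rewrite /nv normc_def /= expr0n expr1n add0r sqrtr1. Qed.

Lemma sqr_imag : imag * imag = -1.
Proof. by rewrite -expr2; exact: sqr_i. Qed.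

Lemma ptE x y : pt x y = Complex x y.
Proof. by rewrite /pt /imag /inC /real_complex_def cplxM cplxD !(mul0r, mul1r, subr0, addr0, add0r, mulr0). Qed.

Lemma seg_cont_addr a b (f : C -> C) (k : C) :
  (forall t, a <= t <= b -> {for inC t + k, continuous f}) ->
  seg_cont a b (fun z => f (z + k)).
Proof.
move=> H t /H /contP cf; apply/contP => e /cf[d d0 {}cf].
by exists d => // v /cf; rewrite addrAC.
Qed.

Lemma seg_cont_addi a b (f : C -> C) (k : C) :
  (forall t, a <= t <= b -> {for k + imag * inC t, continuous f}) ->
  seg_cont a b (fun z => f (k + imag * z)).
Proof.
move=> H t /H /contP cf; apply/contP => e /cf[d d0 {}cf].
by exists d => // v vd; rewrite mulrDr addrA; apply: cf; rewrite nvM nv_imag mul1r.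
Qed.

Definition rect (a b c d : R) (f : C -> C) : C :=
  cint a b (fun z => f (z + imag * inC c)) - cint a b (fun z => f (z + imag * inC d))
  + imag * (cint c d (fun z => f (inC b + imag * z)) - cint c d (fun z => f (inC a + imag * z))).

Definition on_boundary (a b c d x y : R) : Prop :=
  [/\ a <= x <= b, c <= y <= d & [\/ x = a, x = b, y = c | y = d]].

Definition bd_cont a b c d (f : C -> C) : Prop :=
  forall x y, on_boundary a b c d x y -> {for pt x y, continuous f}.

Section fixed.
Variables a b c d : R.
Hypotheses (ab : a <= b) (cd : c <= d).

Lemma bd_cont_sides f : bd_cont a b c d f ->
  [/\ seg_cont a b (fun z => f (z + imag * inC c)), seg_cont a b (fun z => f (z + imag * inC d)),
      seg_cont c d (fun z => f (inC b + imag * z)) & seg_cont c d (fun z => f (inC a + imag * z))].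
Proof.
move=> H; split.
- by apply: seg_cont_addr => t tab; apply: H; split=> //; [rewrite lexx|constructor 3].
- by apply: seg_cont_addr => t tab; apply: H; split=> //; [rewrite lexx andbT|constructor 4].
- by apply: seg_cont_addi => t tab; apply: H; split=> //; [rewrite lexx andbT|constructor 2].
- by apply: seg_cont_addi => t tab; apply: H; split=> //; [rewrite lexx|constructor 1].
Qed.

Lemma rectD f g : bd_cont a b c d f -> bd_cont a b c d g ->
  rect a b c d (fun z => f z + g z) = rect a b c d f + rect a b c d g.
Proof.
move=> /bd_cont_sides[f1 f2 f3 f4] /bd_cont_sides[g1 g2 g3 g4].
by rewrite /rect !cintD //; ring.
Qed.

Lemma rectZ f k : bd_cont a b c d f ->
  rect a b c d (fun z => k * f z) = k * rect a b c d f.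
Proof. by move=> /bd_cont_sides[f1 f2 f3 f4]; rewrite /rect !cintZ //; ring. Qed.

Lemma eq_rect f g : (forall x y, on_boundary a b c d x y -> f (pt x y) = g (pt x y)) ->
  rect a b c d f = rect a b c d g.
Proof.
move=> fg; rewrite /rect; congr (_ - _ + _ * (_ - _)); apply: eq_cint => t tab; apply: fg; split=> //.
all: rewrite ?lexx ?andbT //.
- by constructor 3.
- by constructor 4.
- by constructor 2.
- by constructor 1.
Qed.

Lemma rect_norm f M : bd_cont a b c d f ->
  (forall x y, on_boundary a b c d x y -> nv (f (pt x y)) <= M) ->
  nv (rect a b c d f) <= 4 * M * ((b - a) + (d - c)).
Proof.
move=> /bd_cont_sides[f1 f2 f3 f4] fM.
have h1 : nv (cint a b (fun z => f (z + imag * inC c))) <= 2 * M * (b - a).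
  by apply: cint_norm => // t tab; apply: fM; split=> //; [rewrite lexx|constructor 3].
have h2 : nv (cint a b (fun z => f (z + imag * inC d))) <= 2 * M * (b - a).
  by apply: cint_norm => // t tab; apply: fM; split=> //; [rewrite lexx andbT|constructor 4].
have h3 : nv (cint c d (fun z => f (inC b + imag * z))) <= 2 * M * (d - c).
  by apply: cint_norm => // t tab; apply: fM; split=> //; [rewrite lexx andbT|constructor 2].
have h4 : nv (cint c d (fun z => f (inC a + imag * z))) <= 2 * M * (d - c).
  by apply: cint_norm => // t tab; apply: fM; split=> //; [rewrite lexx|constructor 1].
apply: le_trans (nvD _ _) _; rewrite nvM nv_imag mul1r.
have h5 := nvB (cint a b (fun z => f (z + imag * inC c))) (cint a b (fun z => f (z + imag * inC d))).
have h6 := nvB (cint c d (fun z => f (inC b + imag * z))) (cint c d (fun z => f (inC a + imag * z))).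
lra.
Qed.

Lemma rect_cutx f m : a <= m <= b -> bd_cont a b c d f ->
  rect a b c d f = rect a m c d f + rect m b c d f.
Proof.
move=> amb /bd_cont_sides[f1 f2 f3 f4].
by rewrite /rect (cint_cat amb f1) (cint_cat amb f2); ring.
Qed.

Lemma rect_cuty f m : c <= m <= d -> bd_cont a b c d f ->
  rect a b c d f = rect a b c m f + rect a b m d f.
Proof.
move=> cmd /bd_cont_sides[f1 f2 f3 f4].
by rewrite /rect (cint_cat cmd f3) (cint_cat cmd f4); ring.
Qed.

(** The case of Goursat's theorem in which a primitive is explicit. *)
Lemma rect_affine k0 k1 : rect a b c d (fun z => k0 + k1 * z) = 0.
Proof.
have cc (k : C) x y : seg_cont x y (fun=> k) by move=> t _; exact: cont_cst.
have ci x y : seg_cont x y id by move=> t _; exact: cont_id.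
have ck k x y : seg_cont x y (fun z => k * z).
  by move=> t _; apply: contM; [exact: cont_cst|exact: cont_id].
have E x y k k' : x <= y -> cint x y (fun z => k + k' * z) =
    k * inC (y - x) + k' * inC ((y ^+ 2 - x ^+ 2) / 2).
  by move=> xy; rewrite cintD ?(cintZ (u := id)) ?cint_cst ?cint_id.
have E1 t : cint a b (fun z => k0 + k1 * (z + imag * inC t)) =
   (k0 + k1 * imag * inC t) * inC (b - a) + k1 * inC ((b ^+ 2 - a ^+ 2) / 2).
  by rewrite -E //; congr cint; apply/funext => z; ring.
have E2 t : cint c d (fun z => k0 + k1 * (inC t + imag * z)) =
   (k0 + k1 * inC t) * inC (d - c) + (k1 * imag) * inC ((d ^+ 2 - c ^+ 2) / 2).
  by rewrite -E //; congr cint; apply/funext => z; ring.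
rewrite /rect !E1 !E2 !inCD !inCN; ring.
Qed.
End fixed.

End Rect.

(** * Goursat's theorem *)

Section Goursat.
Variable R : realType.
Local Notation C := (complexes R).
Local Notation inC := (@inC R).

Lemma nested_intervals (l u : nat -> R) :
  (forall k, l k <= l k.+1) -> (forall k, u k.+1 <= u k) -> (forall k, l k <= u k) ->
  exists p, forall k, l k <= p <= u k.
Proof.
move=> lS uS lu.
have lm j k : (j <= k)%N -> l j <= l k.
  by move=> jk; apply: (@nondecreasing_seqP _ _ l).1.
have um j k : (j <= k)%N -> u k <= u j.
  by move=> jk; apply: (@nonincreasing_seqP _ _ u).1.
have lj j k : l j <= u k.
  case: (leqP j k) => [jk|/ltnW kj]; first exact: le_trans (lm _ _ jk) (lu k).
  exact: le_trans (lu j) (um _ _ kj).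
exists (sup (range l)) => k; apply/andP; split.
  apply: ub_le_sup; last by exists k.
  by exists (u 0) => _ [j _ <-].
apply: ge_sup; first by exists (l 0%N); exists 0%N.
by move=> _ [j _ <-].
Qed.

Lemma lt_pow2 (x : R) : exists k, x < 2 ^+ k.
Proof.
have := archi_boundP (normr_ge0 x); set k := Num.bound _ => xk.
exists k; apply: le_lt_trans (ler_norm x) _; apply: lt_trans xk _.
by rewrite -natrX ltr_nat; exact: ltn_expl.
Qed.

Lemma four_sum (a b c d : C) (m : R) : m <= nv (a + b + c + d) ->
  [\/ m <= 4 * nv a, m <= 4 * nv b, m <= 4 * nv c | m <= 4 * nv d].
Proof.
move=> H; have := nvD (a + b + c) d; have := nvD (a + b) c; have := nvD a b.
case: (lerP m (4 * nv a)) => [|h1]; first by constructor 1.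
case: (lerP m (4 * nv b)) => [|h2]; first by constructor 2.
case: (lerP m (4 * nv c)) => [|h3]; first by constructor 3.
case: (lerP m (4 * nv d)) => [|h4]; first by constructor 4.
lra.
Qed.

Lemma ptB (x y x' y' : R) : pt x y - pt x' y' = pt (x - x') (y - y').
Proof. by rewrite /pt !inCD !inCN; ring. Qed.

Lemma nv_pt (x y : R) : nv (pt x y) <= `|x| + `|y|.
Proof. by rewrite (le_trans (nvD _ _)) // nvM nv_imag mul1r !nv_inC. Qed.

Section bisection.
Variables (f : C -> C) (w h : R).
Hypotheses (w0 : 0 <= w) (h0 : 0 <= h).

Let W k : R := w / 2 ^+ k.
Let H k : R := h / 2 ^+ k.
Let m x y k := rect x (x + W k) y (y + H k) f.

Let W2 k : W k = W k.+1 + W k.+1.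
Proof. by rewrite /W exprS; field; rewrite expf_neq0. Qed.
Let H2 k : H k = H k.+1 + H k.+1.
Proof. by rewrite /H exprS; field; rewrite expf_neq0. Qed.
Let W_ge0 k : 0 <= W k. Proof. by rewrite divr_ge0 // exprn_ge0. Qed.
Let H_ge0 k : 0 <= H k. Proof. by rewrite divr_ge0 // exprn_ge0. Qed.

(** The integral is the sum of those over the four quarters, so its norm cannot
    exceed four times that of each of them. *)
Lemma bisect_step (x y : R) k :
  (forall s t : R, x <= s <= x + W k -> y <= t <= y + H k -> {for pt s t, continuous f}) ->
  exists x' y', [/\ x <= x', x' + W k.+1 <= x + W k, y <= y', y' + H k.+1 <= y + H k &
    nv (m x y k) <= 4 * nv (m x' y' k.+1)].
Proof.
move=> cf; have := W2 k; have := H2 k; have := W_ge0 k.+1; have := H_ge0 k.+1.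
set w1 := W k.+1; set h1 := H k.+1 => h1p w1p Ek Wk.
have bc (a b c d : R) : x <= a -> b <= x + W k -> y <= c -> d <= y + H k -> bd_cont a b c d f.
  move=> ? ? ? ? s t [/andP[? ?] /andP[? ?] _]; apply: cf; apply/andP; split; lra.
have E : m x y k = m x y k.+1 + m (x + w1) y k.+1 + m x (y + h1) k.+1 + m (x + w1) (y + h1) k.+1.
  have cx : x <= x + w1 <= x + W k by apply/andP; split; lra.
  have cy : y <= y + h1 <= y + H k by apply/andP; split; lra.
  have xW : x <= x + W k by lra.
  have yH : y <= y + H k by lra.
  have xw : x <= x + w1 by lra.
  have xw' : x + w1 <= x + W k by lra.
  rewrite /m -/w1 -/h1 (rect_cutx xW yH cx); last by apply: bc; lra.
  rewrite (rect_cuty xw yH cy); last by apply: bc; lra.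
  rewrite (rect_cuty xw' yH cy); last by apply: bc; lra.
  have -> : x + W k = x + w1 + w1 by lra.
  have -> : y + H k = y + h1 + h1 by lra.
  by rewrite addrACA addrA.
have /four_sum : nv (m x y k) <= nv (m x y k.+1 + m (x + w1) y k.+1 + m x (y + h1) k.+1
    + m (x + w1) (y + h1) k.+1) by rewrite E.
have lex (u v : R) : 0 <= v -> [/\ u <= u + v, u + v <= u + (v + v) & u + v + v <= u + (v + v)].
  by move=> v0; rewrite addrA !lerDl.
have [x1 x2 x3] := lex x _ w1p; have [y1 y2 y3] := lex y _ h1p.
rewrite -/w1 -/h1 Wk Ek; case=> ?; [exists x, y|exists (x + w1), y|exists x, (y + h1)|exists (x + w1), (y + h1)];
  by split.
Qed.

Lemma bisect_seq (x0 y0 : R) :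
  (forall s t : R, x0 <= s <= x0 + w -> y0 <= t <= y0 + h -> {for pt s t, continuous f}) ->
  exists px py, exists x y : nat -> R, forall k,
   [/\ x0 <= x k <= px, y0 <= y k <= py, px <= x k + W k <= x0 + w, py <= y k + H k <= y0 + h &
    nv (rect x0 (x0 + w) y0 (y0 + h) f) <= 4 ^+ k * nv (m (x k) (y k) k)].
Proof.
move=> cf.
pose ok k (p : R * R) := [/\ x0 <= p.1, p.1 + W k <= x0 + w, y0 <= p.2 & p.2 + H k <= y0 + h].
pose good k (p q : R * R) := [/\ p.1 <= q.1, q.1 + W k.+1 <= p.1 + W k, p.2 <= q.2,
  q.2 + H k.+1 <= p.2 + H k & nv (m p.1 p.2 k) <= 4 * nv (m q.1 q.2 k.+1)].
(* The step is only constrained on rectangles inside the initial one. *)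
have /choice[next nextP] : forall kp : nat * (R * R), exists q, ok kp.1 kp.2 -> good kp.1 kp.2 q.
  move=> [k [x y]]; have [xy_ok|nok] := pselect (ok k (x, y)); last by exists (x, y).
  move: xy_ok; rewrite /ok /= => -[? ? ? ?].
  have [|x' [y' g]] := @bisect_step x y k; last by exists (x', y').
  by move=> s t; rewrite -/(W k) -/(H k) => /andP[? ?] /andP[? ?]; apply: cf; apply/andP; split; lra.
pose fix z k := if k is j.+1 then next (j, z j) else (x0, y0).
have W0 : W 0 = w by rewrite /W expr0 divr1.
have H0 : H 0 = h by rewrite /H expr0 divr1.
have zok k : ok k (z k).
  elim: k => [|k IH]; first by split=> //=; rewrite ?W0 ?H0.
  by have := nextP (k, z k) IH; rewrite /good /= => -[? ? ? ? _]; case: IH => ? ? ? ?; split=> /=; lra.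
have zgood k : good k (z k) (z k.+1) by exact: (nextP (k, z k) (zok k)).
have [px pxP] : exists p, forall k, (z k).1 <= p <= (z k).1 + W k.
  apply: nested_intervals => k; try by case: (zgood k).
  by rewrite lerDl W_ge0.
have [py pyP] : exists p, forall k, (z k).2 <= p <= (z k).2 + H k.
  apply: nested_intervals => k; try by case: (zgood k).
  by rewrite lerDl H_ge0.
have zb k : nv (rect x0 (x0 + w) y0 (y0 + h) f) <= 4 ^+ k * nv (m (z k).1 (z k).2 k).
  elim: k => [|k IH]; first by rewrite expr0 mul1r /m W0 H0.
  apply: le_trans IH _; have [_ _ _ _ g] := zgood k.
  by rewrite exprSr -mulrA ler_pM2l // exprn_gt0.
exists px, py, (fun k => (z k).1), (fun k => (z k).2) => k.
have [? ? ? ?] := zok k; have /andP[? ?] := pxP k; have /andP[? ?] := pyP k.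
by split=> //; apply/andP; split.
Qed.

End bisection.

(** Near a point of differentiability f is affine up to a small error, and
    affine functions integrate to 0, so the integral over a rectangle is
    small compared with the square of its size. This is the estimate that
    contradicts the slow decay of the integral under bisection. *)
Lemma rect_small (f : C -> C) (e del a b c d px py : R) (k1 : C) :
  a <= px <= b -> c <= py <= d -> (b - a) + (d - c) < del -> 0 < e ->
  bd_cont a b c d f ->
  (forall v, nv v < del -> nv (f (pt px py + v) - f (pt px py) - k1 * v) <= e * nv v) ->
  nv (rect a b c d f) <= 4 * e * ((b - a) + (d - c)) ^+ 2.
Proof.
move=> /andP[apx pxb] /andP[cpy pyd] small e0 bf D.
have ab : a <= b by exact: le_trans pxb.
have cd : c <= d by exact: le_trans pyd.
pose A (z : C) := (f (pt px py) - k1 * pt px py) + k1 * z.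
have cA z : {for z, continuous A}.
  by apply: contD; [exact: cont_cst|apply: contM; [exact: cont_cst|exact: cont_id]].
have bA : bd_cont a b c d A by move=> s t _; exact: cA.
have bA' : bd_cont a b c d (fun z => - 1 * A z).
  by move=> s t _; apply: contM; [exact: cont_cst|exact: cA].
have br : bd_cont a b c d (fun z => f z + - 1 * A z).
  by move=> s t o; apply: contD; [exact: bf|exact: bA'].
have -> : rect a b c d f = rect a b c d (fun z => f z + - 1 * A z).
  by rewrite (rectD ab cd bf bA') (rectZ ab cd _ bA) rect_affine // mulr0 addr0.
have -> : 4 * e * ((b - a) + (d - c)) ^+ 2 =
    4 * (e * ((b - a) + (d - c))) * ((b - a) + (d - c)) by ring.
apply: rect_norm => // s t [/andP[? ?] /andP[? ?] _].
have nd : nv (pt s t - pt px py) <= (b - a) + (d - c).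
  rewrite ptB (le_trans (nv_pt _ _)) // lerD // ler_norml; apply/andP; split; lra.
have := D (pt s t - pt px py); rewrite [_ + (_ - _)]addrC subrK.
have -> : f (pt s t) - f (pt px py) - k1 * (pt s t - pt px py) = f (pt s t) + - 1 * A (pt s t).
  by rewrite /A; ring.
move=> H; apply: le_trans (H _) _; first exact: le_lt_trans small.
by rewrite ler_pM2l.
Qed.

Theorem goursat (a b c d : R) (f : C -> C) : a <= b -> c <= d ->
  (forall x y, a <= x <= b -> c <= y <= d -> differentiable f (pt x y)) ->
  rect a b c d f = 0.
Proof.
move=> ab cd df; pose w := b - a; pose h := d - c.
have w0 : 0 <= w by rewrite subr_ge0.
have h0 : 0 <= h by rewrite subr_ge0.
have bE : b = a + w by rewrite /w addrC subrK.
have dE : d = c + h by rewrite /h addrC subrK.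
have cf s t : a <= s <= b -> c <= t <= d -> {for pt s t, continuous f}.
  by move=> ? ?; apply: differentiable_continuous; exact: df.
rewrite bE dE in cf df *; clearbody w h.
have [px [py [x [y P]]]] := bisect_seq w0 h0 cf.
set M := rect _ _ _ _ f in P *.
have dp : differentiable f (pt px py).
  have [/andP[x1 x2] /andP[y1 y2] /andP[x3 x4] /andP[y3 y4] _] := P 0.
  by apply: df; rewrite ?(le_trans x1 x2) ?(le_trans x3 x4) ?(le_trans y1 y2) ?(le_trans y3 y4).
have D := diff_eps dp.
(* Differentiability at the common point of all the rectangles bounds the integral by every multiple of a constant. *)
have key e : 0 < e -> nv M <= e * (4 * (w + h) ^+ 2).
  move=> e0; have [del del0 {}D] := D e e0.
  have [k kP] : exists k, (w + h) / 2 ^+ k < del.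
    have [k kP] := lt_pow2 ((w + h) / del).
    by exists k; rewrite ltr_pdivrMr ?exprn_gt0 // mulrC -ltr_pdivrMr.
  have [/andP[x1 x2] /andP[y1 y2] /andP[x3 x4] /andP[y3 y4]] := P k.
  move=> /le_trans; apply.
  set W := w / 2 ^+ k in x3 x4 *; set H := h / 2 ^+ k in y3 y4 *.
  have WH : W + H = (w + h) / 2 ^+ k by rewrite mulrDl.
  have eWH : x k + W - x k + (y k + H - y k) = W + H by ring.
  have /(_ px py (f^`()%classic (pt px py))) := @rect_small f e del (x k) (x k + W) (y k) (y k + H).
  rewrite eWH x2 x3 y2 y3 WH => /(_ isT isT kP e0).
  have bf : bd_cont (x k) (x k + W) (y k) (y k + H) f.
    move=> s t [/andP[s1 s2] /andP[t1 t2] _]; apply: cf.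
      by rewrite (le_trans x1 s1) (le_trans s2 x4).
    by rewrite (le_trans y1 t1) (le_trans t2 y4).
  move=> /(_ bf) small.
  have -> : e * (4 * (w + h) ^+ 2) = 4 ^+ k * (4 * e * ((w + h) / 2 ^+ k) ^+ 2).
    have -> : 4 ^+ k = 2 ^+ k * 2 ^+ k :> R by rewrite -exprMn; congr (_ ^+ _); ring.
    by field; rewrite expf_neq0.
  rewrite ler_pM2l ?exprn_gt0 //; apply: small => v /D.
  by rewrite diff1E // /= [_ *: _]mulrC.
apply/eqP; rewrite -nv_eq0 eq_le nv_ge0 andbT; apply/ler_addgt0Pl => e e0.
rewrite addr0; set K := 4 * (w + h) ^+ 2 in key.
have K0 : 0 <= K by rewrite mulr_ge0 // sqr_ge0.
have K1 : 0 < K + 1 by rewrite ltr_wpDl.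
apply: le_trans (key (e / (K + 1)) _) _; first by rewrite divr_gt0.
by rewrite mulrAC ler_pdivrMr // ler_pM2l // lerDl.
Qed.
End Goursat.

(** * Cauchy's formula *)

Section Cauchy.
Variable R : realType.
Local Notation C := (complexes R).
Local Notation inC := (@inC R).

Lemma ptRI (z : C) : z = pt (complex.Re z) (complex.Im z).
Proof. by rewrite ptE; case: z. Qed.
Lemma Re_pt (x y : R) : complex.Re (pt x y) = x. Proof. by rewrite ptE. Qed.
Lemma Im_pt (x y : R) : complex.Im (pt x y) = y. Proof. by rewrite ptE. Qed.

(** The rectangle is cut into the small square around the singular point and
    four rectangles avoiding it, to which Goursat's theorem applies. *)
Lemma rect_shrink (a b c d x y del : R) (G : C -> C) :
  0 < del -> a <= x - del -> x + del <= b -> c <= y - del -> y + del <= d ->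
  (forall s t, a <= s <= b -> c <= t <= d -> pt s t != pt x y -> differentiable G (pt s t)) ->
  rect a b c d G = rect (x - del) (x + del) (y - del) (y + del) G.
Proof.
move=> d0 h1 h2 h3 h4 dG.
have bc (a' b' c' d' : R) : a <= a' -> b' <= b -> c <= c' -> d' <= d ->
    ~~ (a' == x) -> ~~ (b' == x) -> ~~ (c' == y) -> ~~ (d' == y) -> bd_cont a' b' c' d' G.
  move=> ? ? ? ? na nb nc nd s t [/andP[? ?] /andP[? ?] H].
  apply: differentiable_continuous; apply: dG; try (apply/andP; split; lra).
  apply/eqP => E; have := Re_pt s t; have := Im_pt s t; rewrite E Re_pt Im_pt => ? ?.
  by move: na nb nc nd; case: H => <-; subst; rewrite eqxx.
have gz (a' b' c' d' : R) : a <= a' -> a' <= b' -> b' <= b -> c <= c' -> c' <= d' -> d' <= d ->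
    (~~ (a' <= x <= b') || ~~ (c' <= y <= d')) -> rect a' b' c' d' G = 0.
  move=> ? ? ? ? ? ? H; apply: goursat => // s t /andP[? ?] /andP[? ?]; apply: dG; try (apply/andP; split; lra).
  apply/eqP => E; have := Re_pt s t; have := Im_pt s t; rewrite E Re_pt Im_pt => ? ?; subst.
  by move: H => /orP[] /negP; apply; apply/andP.
have ne (u : R) : ~~ (u - del == u) by apply/eqP; lra.
have ne' (u : R) : ~~ (u + del == u) by apply/eqP; lra.
have lt1 (u v : R) : u <= v - del -> ~~ (u == v) by move=> ?; apply/eqP; lra.
have lt2 (u v : R) : v + del <= u -> ~~ (u == v) by move=> ?; apply/eqP; lra.
have [? ? ? ?] : [/\ a <= b, c <= d, x - del <= x + del & y - del <= y + del] by split; lra.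
have [? ?] : a <= x + del /\ c <= y + del by split; lra.
have [? ?] : x - del <= b /\ y - del <= d by split; lra.
rewrite (@rect_cutx _ a b c d _ _ G (x + del)) //; last 2 first.
- by apply/andP.
- by apply: bc => //; first [exact: ne|exact: ne'|exact: lt1|exact: lt2].
rewrite (@rect_cutx _ a (x + del) c d _ _ G (x - del)) //; last 2 first.
- by apply/andP.
- by apply: bc => //; first [exact: ne|exact: ne'|exact: lt1|exact: lt2].
rewrite (@rect_cuty _ (x - del) (x + del) c d _ _ G (y + del)) //; last 2 first.
- by apply/andP.
- by apply: bc => //; first [exact: ne|exact: ne'|exact: lt1|exact: lt2].
rewrite (@rect_cuty _ (x - del) (x + del) c (y + del) _ _ G (y - del)) //; last 2 first.
- by apply/andP.
- by apply: bc => //; first [exact: ne|exact: ne'|exact: lt1|exact: lt2].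
rewrite (gz a (x - del) c d) //; last by apply/orP; left; apply/andP; lra.
rewrite (gz (x + del) b c d) //; last by apply/orP; left; apply/andP; lra.
rewrite (gz (x - del) (x + del) c (y - del)) //; last by apply/orP; right; apply/andP; lra.
rewrite (gz (x - del) (x + del) (y + del) d) //; last by apply/orP; right; apply/andP; lra.
by rewrite !addr0 !add0r.
Qed.

Lemma diff_inv_sub (z w : C) : z != w -> differentiable (fun u : C => (u - w)^-1) z.
Proof.
move=> zw; apply: differentiableV; last by rewrite subr_eq0.
by apply: differentiableB; [exact: ex_diff|exact: differentiable_cst].
Qed.

(** The constant of Cauchy's formula, 2 pi i, known here through its
    independence of r and a lower bound. *)
Definition square_winding (r : R) : C := rect (- r) r (- r) r (fun z => z^-1).

Lemma square_windingE r s : 0 < r -> 0 < s -> square_winding r = square_winding s.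
Proof.
wlog rs : r s / r <= s.
  by move=> H r0 s0; case: (lerP r s) => [|/ltW] rs; [|symmetry]; exact: H.
move=> r0 s0; have := @rect_shrink (- s) s (- s) s 0 0 r (fun z => z^-1) r0.
have NN : - s <= - r by rewrite lerN2.
rewrite !sub0r !add0r => /(_ NN rs NN rs) H; symmetry; apply: H => x y _ _ ne.
have -> : (fun z : C => z^-1) = (fun z => (z - 0)^-1).
  by apply/funext => z; rewrite subr0.
by apply: diff_inv_sub; move: ne; rewrite [pt 0 0]ptE.
Qed.

Lemma rect_shift (a b c d x y : R) (f : C -> C) : a <= b -> c <= d ->
  bd_cont (a + x) (b + x) (c + y) (d + y) f ->
  rect (a + x) (b + x) (c + y) (d + y) f = rect a b c d (fun z => f (z + pt x y)).
Proof.
move=> ab cd bf.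
have ab' : a + x <= b + x by rewrite lerD2r.
have cd' : c + y <= d + y by rewrite lerD2r.
have [f1 f2 f3 f4] := bd_cont_sides ab' cd' bf.
have E1 t : (fun z : C => f (z + inC x + imag R * inC (t + y))) =
    (fun z => f (z + imag R * inC t + pt x y)).
  by apply/funext => z; congr f; rewrite /pt inCD; ring.
have E2 t : (fun z : C => f (inC (t + x) + imag R * (z + inC y))) =
    (fun z => f (inC t + imag R * z + pt x y)).
  by apply/funext => z; congr f; rewrite /pt inCD; ring.
by rewrite /rect (cint_shift ab f1) (cint_shift ab f2) (cint_shift cd f3) (cint_shift cd f4) !E1 !E2.
Qed.

Definition winding : C := square_winding 1.

Lemma invrB (A B : C) : A != 0 -> B != 0 -> A^-1 - B^-1 = (B - A) * (A * B)^-1.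
Proof. by move=> A0 B0; field; rewrite A0 B0. Qed.

(** Opposite sides combine to 4 i times the integral of 1 / (1 + t^2) over
    [-1, 1], and the integrand is at least 1/2. *)
Lemma nv_winding : 1 <= nv winding.
Proof.
have N11 : -1 <= 1 :> R by lra.
have bc : bd_cont (-1) 1 (-1) 1 (fun z : C => z^-1).
  move=> s t [_ _ H]; apply: contV; last exact: cont_id.
  apply/eqP => E; have := Re_pt s t; have := Im_pt s t; rewrite E /= => ? ?.
  by case: H; lra.
pose q (z : C) := (1 + z * z)^-1.
have q0 (t : R) : 1 + inC t * inC t = inC (1 + t ^+ 2) by rewrite expr2 inCD inCM.
have qn0 (t : R) : 1 + t ^+ 2 != 0 :> R by rewrite gt_eqF // ltr_wpDr // sqr_ge0.
have qn0C (t : R) : 1 + inC t * inC t != 0.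
  by rewrite q0 -nv_eq0 nv_inC normr_eq0.
have cq : seg_cont (-1) 1 q.
  move=> t _; apply: contV; first exact: qn0C.
  by apply: contD; [exact: cont_cst|apply: contM; exact: cont_id].
have ii := sqr_imag R.
have -> : winding = 4 * imag R * cint (-1) 1 q.
  have [f1 f2 f3 f4] := bd_cont_sides N11 N11 bc.
  have cN (u : C -> C) : seg_cont (-1) 1 u -> seg_cont (-1) 1 (fun z => - u z).
    by move=> cu t tt; apply: contN; exact: cu.
  have cZ k (u : C -> C) : seg_cont (-1) 1 u -> seg_cont (-1) 1 (fun z => k * u z).
    by move=> cu t tt; apply: contM; [exact: cont_cst|exact: cu].
  have cD (u v : C -> C) : seg_cont (-1) 1 u -> seg_cont (-1) 1 v -> seg_cont (-1) 1 (fun z => u z + v z).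
    by move=> cu cv t tt; apply: contD; [exact: cu|exact: cv].
  have f2' := cN _ f2; have f4' := cN _ f4.
  have f12 := cD _ _ f1 f2'; have f34 := cD _ _ f3 f4'.
  rewrite -(cintZ _ cq) /winding /square_winding /rect -(cintN f2) -(cintN f4) -(cintD f1 f2') -(cintD f3 f4').
  rewrite -(cintZ (imag R) f34) -(cintD f12 (cZ (imag R) _ f34)).
  apply: eq_cint => t _; set z := inC t.
  have e1 : (z + imag R * inC (-1)) * (z + imag R * inC 1) = 1 + z * z.
    by rewrite inCN inC1; ring: ii.
  have e2 : (inC 1 + imag R * z) * (inC (-1) + imag R * z) = - (1 + z * z).
    by rewrite inCN inC1; ring: ii.
  have : (z + imag R * inC (-1)) * (z + imag R * inC 1) != 0 by rewrite e1; exact: qn0C.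
  rewrite mulf_eq0 negb_or => /andP[n1 n2].
  have : (inC 1 + imag R * z) * (inC (-1) + imag R * z) != 0 by rewrite e2 oppr_eq0; exact: qn0C.
  rewrite mulf_eq0 negb_or => /andP[n3 n4].
  rewrite (invrB n1 n2) (invrB n3 n4) e1 e2 invrN /q inCN inC1; ring.
rewrite !nvM nv_imag mulr1.
have -> : nv (4 : C) = 4 by rewrite /nv normr_nat -[4%:R]/(4%:R : R[i]) -(rmorph_nat (real_complex R)).
have : 2^-1 * (1 - -1) <= complex.Re (cint (-1) 1 q).
  apply: le_Re_cint => // t /andP[t1 t2].
  rewrite /q q0 -inCV /= lef_pV2 ?posrE //; last by rewrite ltr_wpDr // sqr_ge0.
  suff : t ^+ 2 <= 1 by lra.
  have : 0 <= (1 - t) * (1 + t) by apply: mulr_ge0; lra.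
  by rewrite expr2; lra.
have := nv_Re (cint (-1) 1 q); have := ler_norm (complex.Re (cint (-1) 1 q)).
lra.
Qed.

Section formula.
Variables (a b c d x y : R).
Hypotheses (ax : a < x) (xb : x < b) (cy : c < y) (yd : y < d).

Lemma small_exists (e : R) : 0 < e -> exists del,
  [/\ 0 < del, del <= e, a <= x - del, x + del <= b & (c <= y - del) /\ (y + del <= d)].
Proof.
move=> e0.
exists (Num.min e (Num.min (Num.min (x - a) (b - x)) (Num.min (y - c) (d - y)))).
set m := Num.min e _.
have m0 : 0 < m by rewrite !lt_min !subr_gt0 e0 ax xb cy yd.
have : m <= m by []. rewrite {2}/m !le_min => /andP[? /andP[/andP[? ?] /andP[? ?]]].
by split=> //; try split; lra.
Qed.

Lemma rect_winding : rect a b c d (fun z => (z - pt x y)^-1) = winding.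
Proof.
have [del [d0 _ h1 h2 [h3 h4]]] := small_exists ltr01.
have dI s t : a <= s <= b -> c <= t <= d -> pt s t != pt x y ->
    differentiable (fun z => (z - pt x y)^-1) (pt s t).
  by move=> _ _; exact: diff_inv_sub.
rewrite (rect_shrink d0 h1 h2 h3 h4 dI).
rewrite (addrC x (- del)) (addrC x del) (addrC y (- del)) (addrC y del).
have dd : - del <= del by lra.
rewrite (rect_shift dd dd).
  rewrite /winding -(square_windingE d0 ltr01); congr rect.
  by apply/funext => z; rewrite addrK.
move=> s t [_ _ H]; apply: differentiable_continuous; apply: diff_inv_sub.
apply/eqP => E; have := Re_pt s t; have := Im_pt s t; rewrite E Re_pt Im_pt => ys xs.
by case: H; lra.
Qed.

(** Shrinking the contour to a small square around z0, f becomes almost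
    constant on it, while 1 / (z - z0) is bounded by the inverse of its size. *)
Theorem cauchy_formula (f : C -> C) :
  (forall s t, a <= s <= b -> c <= t <= d -> differentiable f (pt s t)) ->
  rect a b c d (fun z => f z * (z - pt x y)^-1) = f (pt x y) * winding.
Proof.
move=> df; set z0 := pt x y.
have cf : {for z0, continuous f}.
  by apply: differentiable_continuous; apply: (df x y); apply/andP; split; apply: ltW.
have dG (s t : R) : a <= s <= b -> c <= t <= d -> pt s t != z0 ->
    differentiable (fun z => f z * (z - z0)^-1) (pt s t).
  by move=> ? ? ?; apply: differentiableM; [exact: df|exact: diff_inv_sub].
apply/eqP; rewrite -subr_eq0 -nv_eq0 eq_le nv_ge0 andbT; apply/ler_addgt0Pl => e e0.
rewrite addr0.
have e16 : 0 < e / 16 by lra.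
have [r r0 {}cf] := (contP _ _).1 cf _ e16.
have [|del [d0 dr h1 h2 [h3 h4]]] := small_exists (e := r / 3); first by lra.
have dI s t : a <= s <= b -> c <= t <= d -> pt s t != z0 ->
    differentiable (fun z => (z - z0)^-1) (pt s t).
  by move=> _ _; exact: diff_inv_sub.
rewrite -rect_winding (rect_shrink d0 h1 h2 h3 h4 dG) (rect_shrink d0 h1 h2 h3 h4 dI).
have xd : x - del <= x + del by lra.
have yd' : y - del <= y + del by lra.
have nez (s t : R) : on_boundary (x - del) (x + del) (y - del) (y + del) s t -> del <= nv (pt s t - z0).
  move=> [_ _ H]; rewrite ptB.
  have := nv_Re (pt (s - x) (t - y)); have := nv_Im (pt (s - x) (t - y)).
  rewrite Re_pt Im_pt; move=> n1 n2; case: H => E.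
  - by apply: le_trans n2; rewrite E ler_normr; apply/orP; right; lra.
  - by apply: le_trans n2; rewrite E ler_normr; apply/orP; left; lra.
  - by apply: le_trans n1; rewrite E ler_normr; apply/orP; right; lra.
  - by apply: le_trans n1; rewrite E ler_normr; apply/orP; left; lra.
have nez' (s t : R) : on_boundary (x - del) (x + del) (y - del) (y + del) s t -> pt s t != z0.
  by move=> /nez; apply: contraTneq => ->; rewrite subrr nv0 -ltNge.
have ins (s t : R) : on_boundary (x - del) (x + del) (y - del) (y + del) s t -> a <= s <= b /\ c <= t <= d.
  by move=> [/andP[? ?] /andP[? ?] _]; split; apply/andP; split; lra.
have b1 : bd_cont (x - del) (x + del) (y - del) (y + del) (fun z => f z * (z - z0)^-1).
  move=> s t o; apply: differentiable_continuous; have [? ?] := ins _ _ o; apply: dG => //; exact: nez'.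
have b2 : bd_cont (x - del) (x + del) (y - del) (y + del) (fun z => (z - z0)^-1).
  by move=> s t o; apply: differentiable_continuous; apply: diff_inv_sub; exact: nez'.
have b3 : bd_cont (x - del) (x + del) (y - del) (y + del) (fun z => - f z0 * (z - z0)^-1).
  by move=> s t o; apply: contM; [exact: cont_cst|exact: b2].
rewrite -mulNr -(rectZ xd yd' (- f z0) b2) -(rectD xd yd' b1 b3).
have e4 : 4 * (e / 16 / del) * ((x + del - (x - del)) + (y + del - (y - del))) = e.
  by field; rewrite gt_eqF.
rewrite -[leRHS]e4; apply: (rect_norm xd yd').
  by move=> s t o; apply: contD; [exact: b1|exact: b3].
move=> s t o; rewrite -mulrDl nvM nvV.
have zd := nez _ _ o.
have zr : nv (pt s t - z0) < r.
  case: o => /andP[? ?] /andP[? ?] _; rewrite ptB (le_lt_trans (nv_pt _ _)) //.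
  have : `|s - x| <= del by rewrite ler_norml; apply/andP; split; lra.
  have : `|t - y| <= del by rewrite ler_norml; apply/andP; split; lra.
  lra.
have := cf _ zr; rewrite [z0 + _]addrC subrK => /ltW fe.
apply: ler_pM => //; rewrite ?nv_ge0 ?invr_ge0 ?nv_ge0 //.
by rewrite lef_pV2 // posrE // (lt_le_trans d0).
Qed.
End formula.
End Cauchy.

(** * Taylor estimates in one variable *)

Section OneVar.
Variable R : realType.
Local Notation C := (complexes R).
Local Notation inC := (@inC R).

Section disc.
Variables (f : C -> C) (r M : R).
Hypotheses (r0 : 0 < r) (df : forall z, nv z <= 2 * r -> differentiable f z).
Hypothesis fM : forall z, r <= nv z <= 2 * r -> nv (f z) <= M.

Lemma boundary_annulus (s t : R) : on_boundary (- r) r (- r) r s t -> r <= nv (pt s t) <= 2 * r.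
Proof.
move=> [sr tr H]; apply/andP; split.
  have := nv_Re (pt s t); have := nv_Im (pt s t); rewrite Re_pt Im_pt.
  have nr : `|r| = r by rewrite gtr0_norm.
  by case: H => ->; rewrite ?normrN nr.
apply: le_trans (nv_pt _ _) _.
have : `|s| <= r by rewrite ler_norml.
have : `|t| <= r by rewrite ler_norml.
lra.
Qed.

Lemma opp_half_side_le : - r <= r. Proof. by rewrite lerNl; have := r0; lra. Qed.

(** Cauchy's formula reads f(t) as the value of one linear functional, the
    integral of f against the kernel u, normalized by the winding constant, at
    u = 1 / (z - t). Every estimate in one variable comes from expanding this
    kernel. The functional is bounded by the values of f on the annulus
    r <= |z| <= 2 r, which contains the boundary of the square of half side r. *)
Definition sqcoef (u : C -> C) : C := rect (- r) r (- r) r (fun z => f z * u z) / winding R.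

Lemma winding_neq0 : winding R != 0.
Proof. by rewrite -nv_gt0 (lt_le_trans ltr01) // nv_winding. Qed.

Definition annulus_cont (u : C -> C) := forall z, r <= nv z -> nv z <= 2 * r -> {for z, continuous u}.

Lemma bd_cont_sqcoef u : annulus_cont u -> bd_cont (- r) r (- r) r (fun z => f z * u z).
Proof.
move=> cu s t /boundary_annulus /andP[rz zr]; apply: contM; last exact: cu.
by apply: differentiable_continuous; exact: df.
Qed.

Lemma sqcoefD u v : annulus_cont u -> annulus_cont v -> sqcoef (fun z => u z + v z) = sqcoef u + sqcoef v.
Proof.
move=> cu cv; rewrite /sqcoef -mulrDl; congr (_ / _).
rewrite -(rectD opp_half_side_le opp_half_side_le (bd_cont_sqcoef cu) (bd_cont_sqcoef cv)); congr rect.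
by apply/funext => z; rewrite mulrDr.
Qed.

Lemma sqcoefZ k u : annulus_cont u -> sqcoef (fun z => k * u z) = k * sqcoef u.
Proof.
move=> cu; rewrite /sqcoef mulrA; congr (_ / _).
rewrite -(rectZ opp_half_side_le opp_half_side_le k (bd_cont_sqcoef cu)); congr rect.
by apply/funext => z; rewrite mulrCA.
Qed.

Lemma eq_sqcoef u v : (forall z, r <= nv z -> nv z <= 2 * r -> u z = v z) -> sqcoef u = sqcoef v.
Proof.
move=> uv; congr (_ / _); apply: (eq_rect opp_half_side_le opp_half_side_le) => x y /boundary_annulus/andP[h1 h2].
by rewrite uv.
Qed.

Lemma nv_sqcoef u m : annulus_cont u -> (forall z, r <= nv z -> nv z <= 2 * r -> nv (u z) <= m) ->
  nv (sqcoef u) <= 16 * r * M * m.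
Proof.
move=> cu um; rewrite /sqcoef nvM nvV.
have cc1 := nv_winding R; have cp : 0 < nv (winding R) by rewrite (lt_le_trans ltr01).
rewrite ler_pdivrMr //.
have H : nv (rect (- r) r (- r) r (fun z => f z * u z)) <= 4 * (M * m) * ((r - - r) + (r - - r)).
  apply: (rect_norm opp_half_side_le opp_half_side_le (bd_cont_sqcoef cu)) => s t /boundary_annulus rs; have /andP[? ?] := rs.
  by rewrite nvM ler_pM ?nv_ge0 ?fM ?um.
have E : 4 * (M * m) * ((r - - r) + (r - - r)) = 16 * r * M * m by ring.
rewrite E in H; apply: le_trans (H) _; rewrite ler_peMr //.
exact: le_trans (nv_ge0 _) H.
Qed.

Lemma annulus_far (t z : C) : 2 * nv t <= r -> r <= nv z -> r / 2 <= nv (z - t).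
Proof. by move=> ? ?; have := nvD (z - t) t; rewrite subrK; lra. Qed.

Lemma annulus_neq0 (z : C) : r <= nv z -> z != 0.
Proof. by move=> rz; rewrite -nv_gt0 (lt_le_trans r0). Qed.

Lemma annulus_far_neq0 (t z : C) : 2 * nv t <= r -> r <= nv z -> z - t != 0.
Proof.
move=> h1 h2; rewrite -nv_gt0; have := annulus_far h1 h2; have := r0; lra.
Qed.

Lemma annulus_cont_inv t : 2 * nv t <= r -> annulus_cont (fun z => (z - t)^-1).
Proof.
move=> tr z rz _; apply: contV; first exact: annulus_far_neq0.
by apply: contD; [exact: cont_id|exact: cont_cst].
Qed.

Lemma annulus_cont_Vn n : annulus_cont (fun z => z^-1 ^+ n).
Proof.
move=> z rz _; elim: n => [|n IH]; first exact: cont_cst.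
have -> : (fun z : C => z^-1 ^+ n.+1) = (fun z => z^-1 * z^-1 ^+ n).
  by apply/funext => x; rewrite exprS.
apply: contM; last exact: IH.
by apply: contV; [exact: annulus_neq0|exact: cont_id].
Qed.

Lemma sqcoef_inv t : 2 * nv t <= r -> sqcoef (fun z => (z - t)^-1) = f t.
Proof.
move=> tr; have := r0 => r0'.
have /ler_normlP[n1 n2] := nv_Re t; have /ler_normlP[n3 n4] := nv_Im t.
have h1 : - r < complex.Re t by lra.
have h2 : complex.Re t < r by lra.
have h3 : - r < complex.Im t by lra.
have h4 : complex.Im t < r by lra.
have dsq (x y : R) : - r <= x <= r -> - r <= y <= r -> differentiable f (pt x y).
  rewrite -!ler_norml => xr yr; apply: df; have := nv_pt x y; lra.
rewrite /sqcoef; have := cauchy_formula h1 h2 h3 h4 dsq; rewrite -ptRI => ->.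
by rewrite mulfK // winding_neq0.
Qed.

Definition tcoef n := sqcoef (fun z => z^-1 ^+ n.+1).
(** Together with [tcoef], the integrated form of the geometric expansion of
    1 / (z - t) in powers of t; the recursion [tremS] is Taylor's formula. *)
Definition trem n t := sqcoef (fun z => z^-1 ^+ n * (z - t)^-1).

Lemma annulus_cont_trem n t : 2 * nv t <= r -> annulus_cont (fun z => z^-1 ^+ n * (z - t)^-1).
Proof. by move=> tr z h1 h2; apply: contM; [exact: annulus_cont_Vn|exact: annulus_cont_inv]. Qed.

Lemma trem0 t : 2 * nv t <= r -> trem 0 t = f t.
Proof.
move=> tr; rewrite -(sqcoef_inv tr); apply: eq_sqcoef => z _ _.
by rewrite expr0 mul1r.
Qed.

Lemma tremS n t : 2 * nv t <= r -> trem n t = tcoef n + t * trem n.+1 t.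
Proof.
move=> tr; rewrite /trem -(sqcoefZ t (@annulus_cont_trem n.+1 t tr)) -sqcoefD; last 2 first.
- exact: annulus_cont_Vn.
- by move=> z h1 h2; apply: contM; [exact: cont_cst|exact: annulus_cont_trem].
apply: eq_sqcoef => z h1 h2; rewrite exprSr.
have z0 := annulus_neq0 h1; have zt := annulus_far_neq0 tr h1.
set w := z^-1 ^+ n; field; by rewrite z0 zt.
Qed.

Lemma nv_Vn (z : C) n : nv (z^-1 ^+ n) = (nv z)^-1 ^+ n.
Proof. by elim: n => [|n IH]; rewrite ?expr0 ?nv1 // !exprS nvM nvV IH. Qed.

Lemma le_Vn (z : C) n : r <= nv z -> nv (z^-1 ^+ n) <= r^-1 ^+ n.
Proof.
move=> rz; rewrite nv_Vn; apply: lerXn2r; rewrite ?nnegrE ?invr_ge0 ?nv_ge0 ?(ltW r0) //.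
by rewrite lef_pV2 // posrE // (lt_le_trans r0).
Qed.

Lemma nv_annulus_inv t (z : C) : 2 * nv t <= r -> r <= nv z -> nv (z - t)^-1 <= 2 / r.
Proof.
move=> h1 h2; rewrite nvV -[2 / r]invf_div lef_pV2 ?posrE ?divr_gt0 //.
  exact: annulus_far.
by apply: lt_le_trans (annulus_far h1 h2); rewrite divr_gt0.
Qed.

Lemma nv_trem n t : 2 * nv t <= r -> nv (trem n t) <= 32 * M * r^-1 ^+ n.
Proof.
move=> tr; have -> : 32 * M * r^-1 ^+ n = 16 * r * M * (r^-1 ^+ n * (2 / r)).
  by set w := r^-1 ^+ n; field; rewrite gt_eqF.
apply: (nv_sqcoef (@annulus_cont_trem n t tr)) => z h1 h2; rewrite nvM.
by apply: ler_pM; rewrite ?nv_ge0 ?le_Vn ?nv_annulus_inv.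
Qed.

Lemma center_le : 2 * nv (0 : C) <= r. Proof. by rewrite nv0 mulr0 ltW. Qed.

Lemma f0_tcoef : f 0 = tcoef 0.
Proof. by rewrite -(trem0 center_le) (tremS 0 center_le) mul0r addr0. Qed.

(** The maximum principle up to a constant factor; only values on the annulus
    enter, so that it applies to the inverse of a function known to be large
    there only. *)
Theorem cauchy_max : nv (f 0) <= 32 * M.
Proof. by rewrite -(trem0 center_le); have := nv_trem 0 center_le; rewrite expr0 mulr1. Qed.

Theorem cauchy_taylor2 t : 2 * nv t <= r ->
  nv (f t - f 0 - tcoef 1 * t) <= 32 * M * r^-1 ^+ 2 * nv t ^+ 2.
Proof.
move=> tr; rewrite f0_tcoef -(trem0 tr) (tremS 0 tr) (tremS 1 tr).
have -> : tcoef 0 + t * (tcoef 1 + t * trem 2 t) - tcoef 0 - tcoef 1 * t = t * t * trem 2 t.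
  by move: (tcoef 0) (tcoef 1) (trem 2 t) => u v w; ring.
rewrite (nvM (t * t)) (nvM t) -expr2 mulrC; apply: ler_pM; rewrite ?nv_ge0 ?exprn_ge0 ?nv_ge0 //.
exact: nv_trem.
Qed.

Theorem cauchy_taylor3 t : 2 * nv t <= r ->
  nv (f t - f 0 - tcoef 1 * t - tcoef 2 * (t * t)) <= 32 * M * r^-1 ^+ 3 * nv t ^+ 3.
Proof.
move=> tr; rewrite f0_tcoef -(trem0 tr) (tremS 0 tr) (tremS 1 tr) (tremS 2 tr).
have -> : tcoef 0 + t * (tcoef 1 + t * (tcoef 2 + t * trem 3 t)) - tcoef 0 - tcoef 1 * t
   - tcoef 2 * (t * t) = t * t * t * trem 3 t.
  by move: (tcoef 0) (tcoef 1) (tcoef 2) (trem 3 t) => u v w x; ring.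
rewrite (nvM (t * t * t)) (nvM (t * t)) (nvM t) -expr2 -exprSr mulrC; apply: ler_pM; rewrite ?nv_ge0 ?exprn_ge0 ?nv_ge0 //.
exact: nv_trem.
Qed.

Theorem cauchy_lip t s : 2 * nv t <= r -> 2 * nv s <= r ->
  nv (f t - f s) <= 64 * M * r^-1 * nv (t - s).
Proof.
move=> tr sr; set w := fun z : C => (z - t)^-1 * (z - s)^-1.
have cw : annulus_cont w by move=> z h1 h2; apply: contM; exact: annulus_cont_inv.
have -> : f t - f s = (t - s) * sqcoef w.
  rewrite -(sqcoef_inv tr) -(sqcoef_inv sr) -(sqcoefZ (t - s) cw).
  rewrite -[sqcoef _ - _]addr0; apply/eqP; rewrite addr0 subr_eq addrC -sqcoefD; last 2 first.
  - exact: annulus_cont_inv.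
  - by move=> z h1 h2; apply: contM; [exact: cont_cst|exact: cw].
  apply/eqP; apply: eq_sqcoef => z h1 h2; rewrite /w.
  by field; rewrite (annulus_far_neq0 tr h1) (annulus_far_neq0 sr h1).
rewrite (nvM (t - s)) mulrC; apply: ler_pM; rewrite ?nv_ge0 //.
have -> : 64 * M * r^-1 = 16 * r * M * ((2 / r) * (2 / r)) by field; rewrite gt_eqF.
apply: (nv_sqcoef cw) => z h1 h2; rewrite nvM.
by apply: ler_pM; rewrite ?nv_ge0 ?nv_annulus_inv.
Qed.

End disc.
End OneVar.

(** * Differentials in several variables *)

Section Several.
Variable R : realType.
Local Notation C := (complexes R).
Local Notation inC := (@inC R).

Lemma linear_pack (U W : lmodType C) (L : U -> W) : linear L ->
  exists L' : {linear U -> W}, L' = L :> (U -> W).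
Proof.
move=> h; pose m := GRing.isLinear.Build _ _ _ _ L h.
by pose L' : {linear U -> W} := HB.pack L m; exists L'.
Qed.

Section row.
Variable n : nat.
Local Notation V := 'rV[C]_n.

(** Because a linear form is a combination of the coordinates. *)
Lemma row_linear_cont (L : {linear V -> C}) : continuous L.
Proof.
move=> x; have -> : (L : V -> C) = (fun v => \sum_(i < n) v 0 i * L (delta_mx 0 i)).
  apply/funext => v; rewrite {1}(row_sum_delta v) linear_sum; apply: eq_bigr => i _.
  by rewrite linearZ.
apply: differentiable_continuous.
have -> : (fun v : V => \sum_(i < n) v 0 i * L (delta_mx 0 i)) =
   \sum_(i < n) (fun v : V => v 0 i * L (delta_mx 0 i)).
  by apply/funext => v; rewrite fct_sumE.
apply: differentiable_sum => i; apply: differentiableM; last exact: differentiable_cst.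
exact: differentiable_coord.
Qed.

Lemma row_is_diff (f L : V -> C) (x : V) : linear L ->
  (forall e, 0 < e -> exists2 d, 0 < d &
     forall v, nv v < d -> nv (f (x + v) - f x - L v) <= e * nv v) ->
  is_diff x f L.
Proof.
move=> /linear_pack[L' <-]; apply: eps_diff; exact: row_linear_cont.
Qed.
End row.

Lemma quad_eps (V W : normedModType C) (f : V -> W) (L : V -> W) (x : V) (K d : R) : 0 < d ->
  (forall v, nv v <= d -> nv (f (x + v) - f x - L v) <= K * nv v ^+ 2) ->
  forall e, 0 < e -> exists2 d, 0 < d &
     forall v, nv v < d -> nv (f (x + v) - f x - L v) <= e * nv v.
Proof.
move=> d0 H e e0; have K1 : 0 < `|K| + 1 by rewrite ltr_wpDl.
exists (Num.min d (e / (`|K| + 1))); first by rewrite lt_min d0 divr_gt0.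
move=> v; rewrite lt_min => /andP[/ltW vd]; rewrite ltr_pdivlMr // => ve.
apply: le_trans (H v vd) _; rewrite expr2 mulrA ler_wpM2r ?nv_ge0 //.
apply: le_trans (ltW ve); rewrite mulrC ler_wpM2l ?nv_ge0 //.
by have := ler_norm K; lra.
Qed.

Lemma mul_is_diff (f : C -> C) (k x : C) :
  (forall e, 0 < e -> exists2 d, 0 < d &
     forall v, nv v < d -> nv (f (x + v) - f x - k * v) <= e * nv v) ->
  is_diff x f (fun v => k * v).
Proof.
have lk : linear (fun v : C => k * v).
  by move=> a u v; rewrite mulrDr /GRing.scale /= mulrCA.
have [L LE] := linear_pack lk; rewrite -LE => H; apply: eps_diff; last first.
  by move=> e /H[d d0 {}H]; exists d => // v /H; rewrite LE.
by rewrite LE => z; apply: contM; [exact: cont_cst|exact: cont_id].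
Qed.

Lemma diff_near_eq (V W : normedModType C) (f g : V -> W) (x : V) (d : R) : 0 < d ->
  (forall v, nv v < d -> f (x + v) = g (x + v)) -> differentiable f x ->
  differentiable g x.
Proof.
move=> d0 fg df; have : is_diff x g ('d f x); last by move=> h; exact: ex_diff.
apply: eps_diff; first exact: diff_continuous.
move=> e e0; have [d' d'0 H] := diff_eps df e0.
exists (Num.min d d'); first by rewrite lt_min d0.
move=> v; rewrite lt_min => /andP[vd /H]; rewrite fg // -[X in _ - f X]addr0 fg ?addr0 //.
by rewrite nv0.
Qed.

Lemma diff_line (V W : normedModType C) (f : V -> W) (z e : V) (t : C) :
  differentiable f (z + t *: e) -> differentiable (fun t : C => f (z + t *: e)) t /\
    'd (fun t : C => f (z + t *: e)) t 1 = 'd f (z + t *: e) e.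
Proof.
move=> df.
have ld : is_diff t (fun t : C => z + t *: e) (fun t => t *: e).
  rewrite -[X in is_diff _ _ X]add0r.
  exact: is_diffD (is_diff_cst _ _) (is_diff_scalel _ _).
have dl : differentiable (fun t : C => z + t *: e) t by exact: ex_diff.
split; first by apply: (differentiable_comp dl df).
have -> : (fun t : C => f (z + t *: e)) = f \o (fun t : C => z + t *: e) by [].
by rewrite diff_comp //= diff_val scale1r.
Qed.

Lemma diff_bounded (V W : normedModType C) (f : V -> W) (x : V) : differentiable f x ->
  exists2 B : R, 0 < B & forall v, nv ('d f x v) <= B * nv v.
Proof.
move=> df; have /contP /(_ _ ltr01) [d d0 H] : {for 0, continuous ('d f x)} by exact: diff_continuous.
exists (2 / d); first by rewrite divr_gt0.
move=> v; have [->|v0] := eqVneq v 0; first by rewrite linear0 !nv0 mulr0.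
have vp : 0 < nv v by rewrite nv_gt0.
pose k := d / (2 * nv v); have k0 : 0 < k by rewrite divr_gt0 // mulr_gt0.
have := H (inC k *: v); rewrite linear0 subr0 add0r linearZ !nvZ nv_inC gtr0_norm //.
have kv : k * nv v = d / 2 by rewrite /k; field; rewrite gt_eqF.
have d2 : d / 2 < d by lra.
rewrite kv => /(_ d2)/ltW kL; rewrite -(ler_pM2l k0) (le_trans kL) // mulrCA kv.
by rewrite -[2 / d]invf_div mulVf // gt_eqF // divr_gt0.
Qed.

(** Cauchy's estimate on the complex line through y in the direction of v; the
    constant does not depend on that direction. *)
Lemma second_order (V : normedModType C) (f : V -> C) (y : V) (r M : R) : 0 < r ->
  (forall v, nv v <= 2 * r -> differentiable f (y + v)) ->
  (forall v, nv v <= 2 * r -> nv (f (y + v)) <= M) ->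
  forall v, 2 * nv v <= r ->
    nv (f (y + v) - f y - 'd f y v) <= 32 * M * r^-1 ^+ 2 * nv v ^+ 2.
Proof.
move=> r0 df fM v vr.
have [->|v0] := eqVneq v 0.
  by rewrite addr0 subrr linear0 subr0 !nv0 expr0n mulr0.
have vp : 0 < nv v by rewrite nv_gt0.
pose u := inC (nv v)^-1 *: v.
have u1 : nv u = 1 by rewrite nvZ nv_inC gtr0_norm ?invr_gt0 // mulVf // gt_eqF.
have vu : inC (nv v) *: u = v.
  rewrite scalerA -inCM mulfV ?gt_eqF // [inC 1]inC1 scale1r //.
pose g (t : C) := f (y + t *: u).
have gd z : nv z <= 2 * r -> differentiable g z.
  by move=> zr; apply: (proj1 (diff_line _)); apply: df; rewrite nvZ u1 mulr1.
have gM z : r <= nv z <= 2 * r -> nv (g z) <= M.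
  by move=> /andP[_ zr]; apply: fM; rewrite nvZ u1 mulr1.
have T := cauchy_taylor2 r0 gd gM.
have dg : is_diff 0 g (fun t => tcoef g r 1 * t).
  apply: mul_is_diff; apply: (@quad_eps _ _ _ _ _ (32 * M * r^-1 ^+ 2) (r / 2)); first by rewrite divr_gt0.
  by move=> t tr; rewrite add0r; apply: T; lra.
have y0 : y + (0 : C) *: u = y by rewrite scale0r addr0.
have dfy : differentiable f (y + (0 : C) *: u).
  by rewrite y0 -[y]addr0; apply: df; rewrite nv0 mulr_ge0 // ltW.
have c1 : tcoef g r 1 = 'd f y u.
  have [_] := diff_line dfy; rewrite y0 => <-.
  by rewrite -/g diff_val mulr1.
have := T (inC (nv v)); rewrite nv_inC gtr0_norm // => /(_ vr).
rewrite /g vu y0 c1 mulrC -[inC _ * _]/(inC (nv v) *: _) -linearZ /=.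
by rewrite vu.
Qed.

(** The third order Taylor estimate makes the quotient by t affine up to a
    quadratic error. *)
Lemma removable (g : C -> C) (r M : R) : 0 < r ->
  (forall z, nv z <= 2 * r -> differentiable g z) ->
  (forall z, r <= nv z <= 2 * r -> nv (g z) <= M) -> g 0 = 0 ->
  differentiable (fun t => if t == 0 then 'd g 0 1 else g t / t) 0.
Proof.
move=> r0 gd gM g0; set q := fun t => _.
have T2 := cauchy_taylor2 r0 gd gM; have T3 := cauchy_taylor3 r0 gd gM.
have dg : is_diff 0 g (fun t => tcoef g r 1 * t).
  apply: mul_is_diff; apply: (@quad_eps _ _ _ _ _ (32 * M * r^-1 ^+ 2) (r / 2)); first by rewrite divr_gt0.
  by move=> t tr; rewrite add0r; apply: T2; lra.
have c1 : 'd g 0 1 = tcoef g r 1 by rewrite diff_val mulr1.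
have : is_diff 0 q (fun t => tcoef g r 2 * t); last by move=> h; exact: ex_diff.
apply: mul_is_diff; apply: (@quad_eps _ _ _ _ _ (32 * M * r^-1 ^+ 3) (r / 2)); first by rewrite divr_gt0.
move=> t tr; rewrite add0r /q eqxx c1; case: eqVneq => [->|t0].
  by rewrite subrr mulr0 subr0 !nv0 expr0n mulr0.
have tp : 0 < nv t by rewrite nv_gt0.
rewrite -(ler_pM2r tp) -nvM.
have -> : (g t / t - tcoef g r 1 - tcoef g r 2 * t) * t =
   g t - g 0 - tcoef g r 1 * t - tcoef g r 2 * (t * t).
  by rewrite g0; move: (tcoef g r 1) (tcoef g r 2) (g t) => a b c; field.
have tr' : 2 * nv t <= r by lra.
by have := T3 t tr'; rewrite [nv t ^+ 3]exprSr mulrA.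
Qed.

End Several.

(** * Differentiability across a hypersurface *)

Section Hartogs.
Variable R : realType.
Local Notation C := (complexes R).
Local Notation inC := (@inC R).

(** Continuity passes to uniform limits; it is stated pointwise because the
    approximating difference quotients are only controlled near x. *)
Lemma cont_approx (V W : normedModType C) (G : V -> W) (x : V) :
  (forall e, 0 < e -> exists phi : V -> W, {for x, continuous phi} /\
     exists2 d, 0 < d & forall v, nv v < d -> nv (G (x + v) - phi (x + v)) <= e) ->
  {for x, continuous G}.
Proof.
move=> H; apply/contP => e e0; have e4 : 0 < e / 4 by rewrite divr_gt0.
have [phi [/contP /(_ _ e4)[d1 d10 c1] [d d0 c]]] := H _ e4.
exists (Num.min d d1); first by rewrite lt_min d0.
move=> v; rewrite lt_min => /andP[vd vd1].
have c0' := c 0; rewrite nv0 addr0 in c0'.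
have := c _ vd; have := c1 _ vd1; have := c0' d0.
have -> : G (x + v) - G x = (G (x + v) - phi (x + v)) + (phi (x + v) - phi x) - (G x - phi x).
  by rewrite addrA subrK opprB addrA subrK.
have := nvB (G (x + v) - phi (x + v) + (phi (x + v) - phi x)) (G x - phi x).
have := nvD (G (x + v) - phi (x + v)) (phi (x + v) - phi x).
lra.
Qed.

Section mean.
Variable r : R.
Hypothesis r0 : 0 < r.

(** By Cauchy's formula this mean is the value at the centre when u is
    holomorphic ([cmean_center]). *)
Definition cmean (u : C -> C) : C := sqcoef (fun=> 1) r (fun t => u t * t^-1).

Let d1 (z : C) : nv z <= 2 * r -> differentiable (fun _ : C => 1 : C) z.
Proof. by move=> _; exact: differentiable_cst. Qed.

Lemma annulus_cont_mean u : annulus_cont r u -> annulus_cont r (fun t => u t * t^-1).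
Proof.
move=> cu t h1 h2; apply: contM; first exact: cu.
by apply: contV; [exact: (annulus_neq0 r0)|exact: cont_id].
Qed.

Lemma cmeanD u v : annulus_cont r u -> annulus_cont r v -> cmean (fun t => u t + v t) = cmean u + cmean v.
Proof.
move=> cu cv; rewrite /cmean -(sqcoefD r0 d1 (annulus_cont_mean cu) (annulus_cont_mean cv)).
by congr sqcoef; apply/funext => t; rewrite mulrDl.
Qed.

Lemma cmeanZ k u : annulus_cont r u -> cmean (fun t => k * u t) = k * cmean u.
Proof.
move=> cu; rewrite /cmean -(sqcoefZ r0 d1 k (annulus_cont_mean cu)).
by congr sqcoef; apply/funext => t; rewrite mulrA.
Qed.

Lemma nv_cmean u m : annulus_cont r u -> (forall t, r <= nv t -> nv t <= 2 * r -> nv (u t) <= m) ->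
  nv (cmean u) <= 16 * m.
Proof.
move=> cu um; have -> : 16 * m = 16 * r * 1 * (m * r^-1) by field; rewrite gt_eqF.
apply: (nv_sqcoef r0 d1 _ (annulus_cont_mean cu)); first by move=> z _; rewrite nv1.
move=> t h1 h2; rewrite nvM nvV; apply: ler_pM; rewrite ?nv_ge0 ?invr_ge0 ?nv_ge0 ?um //.
by rewrite lef_pV2 // posrE // (lt_le_trans r0).
Qed.

Lemma cmean_center (f : C -> C) : (forall z, nv z <= 2 * r -> differentiable f z) ->
  cmean f = f 0.
Proof.
move=> df; rewrite -(sqcoef_inv r0 df (center_le r0)) /cmean /sqcoef; congr (rect _ _ _ _ _ / _).
by apply/funext => z; rewrite mul1r subr0.
Qed.
End mean.

Variable n : nat.
Local Notation V := 'rV[C]_n.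

(** On the line through z + v parallel to e, Cauchy's formula expresses H(z + v)
    as a mean of the values H(z + t e + v), where t is on the boundary of a
    square. There H is differentiable with a uniform second order estimate, so
    the mean over t of the differentials at z + t e is the differential at z. *)
Theorem hartogs_line (H : V -> C) (z e : V) (r rho M : R) : 0 < r -> 0 < rho ->
  (forall (t : C) v, r <= nv t <= 2 * r -> nv v <= 2 * rho ->
     differentiable H (z + t *: e + v) /\ nv (H (z + t *: e + v)) <= M) ->
  (forall v (s : C), nv v <= rho -> nv s <= 2 * r ->
     differentiable (fun t : C => H (z + v + t *: e)) s) ->
  differentiable H z.
Proof.
move=> r0 rho0 hb hl.
pose rh := rho / 2; have rh0 : 0 < rh by rewrite divr_gt0.
pose K := 32 * M * rh^-1 ^+ 2.
pose D (t : C) v := 'd H (z + t *: e) v.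
have dH (t : C) : r <= nv t -> nv t <= 2 * r -> differentiable H (z + t *: e).
  move=> h1 h2; rewrite -[_ + _]addr0; apply: (proj1 (hb _ _ _ _)); first by rewrite h1.
  by rewrite nv0 mulr_ge0 // ltW.
(* the annulus is closed, so points slightly outside of it are needed too *)
have S (t d : C) v : r <= nv t -> nv t <= 2 * r -> nv d * nv e <= rho -> 2 * nv v <= rh ->
    nv (H (z + (t + d) *: e + v) - H (z + (t + d) *: e) - D (t + d) v) <= K * nv v ^+ 2.
  move=> h1 h2 de vr.
  have nde w : nv w <= 2 * rh -> nv (d *: e + w) <= 2 * rho.
    move=> wr; have := nvD (d *: e) w; rewrite nvZ; move: wr; rewrite /rh; lra.
  have E w : z + (t + d) *: e + w = z + t *: e + (d *: e + w).
    by rewrite scalerDl !addrA.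
  have tA : r <= nv t <= 2 * r by rewrite h1.
  apply: second_order => // w wr; rewrite E.
    by case: (hb t (d *: e + w) tA (nde w wr)).
  by case: (hb t (d *: e + w) tA (nde w wr)).
have S0 (t : C) v : r <= nv t -> nv t <= 2 * r -> 2 * nv v <= rh ->
    nv (H (z + t *: e + v) - H (z + t *: e) - D t v) <= K * nv v ^+ 2.
  by move=> h1 h2 vr; have := S t 0 v h1 h2; rewrite addr0 nv0 mul0r; apply => //; exact: ltW.
have cH v : nv v <= 2 * rho -> annulus_cont r (fun t => H (z + t *: e + v)).
  move=> vr t h1 h2; apply: differentiable_continuous.
  have -> : (fun t : C => H (z + t *: e + v)) = (fun t => H (z + v + t *: e)).
    by apply/funext => s; rewrite addrAC.
  apply: (proj1 (diff_line _)); rewrite addrAC; apply: (proj1 (hb _ _ _ _)) => //.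
  by rewrite h1.
have K1 : 0 < `|K| + 1 by rewrite ltr_wpDl.
have cD v : annulus_cont r (fun t => D t v).
  move=> t h1 h2; apply: cont_approx => eps eps0.
  pose nv1 := nv v + 1; have nv1p : 0 < nv1 by rewrite ltr_wpDl // nv_ge0.
  (* The difference quotient of step s approximates D (t + d) v within eps, uniformly in d. *)
  pose s := Num.min (rh / (2 * nv1)) (eps / ((`|K| + 1) * nv1 ^+ 2)).
  have s0 : 0 < s.
    by rewrite lt_min !divr_gt0 // mulr_gt0 // exprn_gt0.
  have s1 : s * (2 * nv1) <= rh by rewrite -ler_pdivlMr ?mulr_gt0 // ge_min lexx.
  have s2 : s * ((`|K| + 1) * nv1 ^+ 2) <= eps.
    by rewrite -ler_pdivlMr ?mulr_gt0 ?exprn_gt0 // ge_min lexx orbT.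
  have sv : nv (inC s *: v) = s * nv v by rewrite nvZ nv_inC gtr0_norm.
  have svr : 2 * nv (inC s *: v) <= rh.
    rewrite sv; apply: le_trans s1; rewrite mulrCA ler_pM2l // ler_pM2l // lerDl //.
  exists (fun t => (inC s)^-1 * (H (z + t *: e + inC s *: v) - H (z + t *: e))); split.
    apply: contM; first exact: cont_cst.
    apply: contD; first by apply: cH => //; move: svr; rewrite /rh; lra.
    apply: contN; have := @cH 0 _ t h1 h2; rewrite nv0.
    have -> : (fun t : C => H (z + t *: e + 0)) = (fun t => H (z + t *: e)).
      by apply/funext => u; rewrite addr0.
    by apply; rewrite mulr_ge0 // ltW.
  exists (rho / (nv e + 1)); first by rewrite divr_gt0 // ltr_wpDl // nv_ge0.
  move=> d; rewrite ltr_pdivlMr ?ltr_wpDl ?nv_ge0 // => dr.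
  have de : nv d * nv e <= rho.
    by apply: le_trans (ltW dr); rewrite ler_wpM2l ?nv_ge0 // lerDl.
  have := S t d _ h1 h2 de svr; rewrite /D linearZ /=.
  set a := H _; set b := H _; set g := 'd H _ v => h.
  have sC : inC s != 0 by rewrite -nv_eq0 nv_inC normr_eq0 gt_eqF.
  have -> : g - (inC s)^-1 * (a - b) = - ((inC s)^-1 * (a - b - inC s *: g)).
    by rewrite /GRing.scale /=; field.
  rewrite nvN nvM nvV nv_inC gtr0_norm // -(ler_pM2l s0) mulrA mulfV ?gt_eqF // mul1r.
  apply: le_trans h _; rewrite sv.
  have -> : K * (s * nv v) ^+ 2 = s * (s * (K * nv v ^+ 2)) by ring.
  rewrite ler_pM2l //; apply: le_trans s2; rewrite ler_pM2l //.
  have KK : K <= `|K| + 1 by have := ler_norm K; lra.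
  apply: le_trans (_ : (`|K| + 1) * nv v ^+ 2 <= _).
    by rewrite ler_wpM2r // exprn_ge0 // nv_ge0.
  by rewrite ler_pM2l // lerXn2r ?nnegrE ?nv_ge0 ?(ltW nv1p) // lerDl.
pose L v := cmean r (fun t => D t v).
have linL : linear L.
  move=> k u v; rewrite /L -[k *: cmean _ _]/(k * cmean _ _) -(cmeanZ r0 k (cD u)) -(cmeanD r0 _ (cD v)).
    by congr cmean; apply/funext => t; rewrite /D linearP.
  by move=> t h1 h2; apply: contM; [exact: cont_cst|exact: cD].
have : is_diff z H L; last by move=> h; exact: ex_diff.
apply: row_is_diff => //.
have d0' : 0 < Num.min (rh / 2) rho by rewrite lt_min rho0 divr_gt0.
apply: (quad_eps (K := 16 * K) d0') => v; rewrite le_min => /andP[vr vrho].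
have Hc w : nv w <= rho -> H (z + w) = cmean r (fun t => H (z + t *: e + w)).
  move=> wr; have -> : (fun t : C => H (z + t *: e + w)) = (fun t => H (z + w + t *: e)).
    by apply/funext => s; rewrite addrAC.
  by rewrite cmean_center ?scale0r ?addr0 // => s; exact: hl.
have z0 : nv (0 : V) <= rho by rewrite nv0 ltW.
have -> : H z = H (z + 0) by rewrite addr0.
have v2 : nv v <= 2 * rho by have := rho0; lra.
have z2 : nv (0 : V) <= 2 * rho by rewrite nv0 mulr_ge0 // ltW.
have cN u : annulus_cont r u -> annulus_cont r (fun t => -1 * u t).
  by move=> cu t h1 h2; apply: contM; [exact: cont_cst|exact: cu].
pose a t := H (z + t *: e + v); pose b t := H (z + t *: e + 0); pose c t := D t v.
have ca : annulus_cont r a := cH v v2; have cb : annulus_cont r b := cH 0 z2; have cD' : annulus_cont r c := cD v.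
have cab : annulus_cont r (fun t => a t + -1 * b t).
  by move=> t h1 h2; apply: contD; [exact: ca|exact: (cN _ cb)].
have E : cmean r (fun t => a t + -1 * b t + -1 * c t) = cmean r a - cmean r b - cmean r c.
  rewrite (cmeanD r0 cab (cN _ cD')) (cmeanD r0 ca (cN _ cb)).
  by rewrite (cmeanZ r0 (-1) cb) (cmeanZ r0 (-1) cD') !mulN1r.
rewrite (Hc v vrho) (Hc 0 z0) -/a -/b /L -/c -E -mulrA.
apply: (nv_cmean r0).
  by move=> t h1 h2; apply: contD; [exact: cab|exact: (cN _ cD')].
move=> t h1 h2; rewrite !mulN1r /a /b /c addr0; apply: S0 => //.
by move: vr; rewrite /rh; have := rho0; lra.
Qed.

End Hartogs.

(** * The implicit function theorem *)

Section Implicit.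
Variable R : realType.
Local Notation C := (complexes R).
Local Notation inC := (@inC R).

Lemma nv_lipB (a b : C) : nv a - nv b <= nv (a - b).
Proof. by rewrite lerBlDr; have := nvD (a - b) b; rewrite subrK. Qed.

(** Apply the Lipschitz form of Cauchy's estimate to the function
    t |-> A(x + t e) - t - (A 0 + 'd A 0 x): on a disc of radius comparable to
    r it is o(r), because A is differentiable at 0. *)
Lemma strict_estimate (V : normedModType C) (A : V -> C) (e : V) (del : R) : 0 < del ->
  (forall y, nv y < del -> differentiable A y) -> 'd A 0 e = 1 ->
  exists2 r, 0 < r & (forall x (t : C), nv x <= r -> nv t <= r -> nv (x + t *: e) < del) /\
   forall x (t s : C), nv x <= r -> nv t <= r -> nv s <= r ->
     nv (A (x + t *: e) - A (x + s *: e) - (t - s)) <= 2^-1 * nv (t - s).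
Proof.
move=> del0 dA dAe.
have e4 : 0 < 1 + 4 * nv e by rewrite ltr_pwDl // mulr_ge0 ?nv_ge0.
(* 64 is the constant of cauchy_lip; with the radius 2 r used below, the bound becomes 1/2. *)
pose eps := (64 * (1 + 4 * nv e))^-1.
have eps0 : 0 < eps by rewrite invr_gt0 mulr_gt0.
have dA0 : differentiable A 0 by apply: dA; rewrite nv0.
have [d d0 D] := diff_eps dA0 eps0.
pose m := Num.min d del; have m0 : 0 < m by rewrite lt_min d0.
pose r := m / (2 * (1 + 4 * nv e)).
have r0 : 0 < r by rewrite divr_gt0 // mulr_gt0.
have rE : r * (1 + 4 * nv e) = m / 2 by rewrite /r; field; rewrite gt_eqF.
have small x (t : C) : nv x <= r -> nv t <= 4 * r -> nv (x + t *: e) <= r * (1 + 4 * nv e).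
  move=> xr tr; apply: le_trans (nvD _ _) _; rewrite nvZ mulrDr mulr1.
  by apply: lerD => //; rewrite mulrA [r * 4]mulrC ler_wpM2r ?nv_ge0.
have small' x (t : C) : nv x <= r -> nv t <= 4 * r -> nv (x + t *: e) < m.
  by move=> xr tr; apply: le_lt_trans (small x t xr tr) _; rewrite rE; have := m0; lra.
exists r => //; split.
  move=> x t xr tr; have : nv (x + t *: e) < m by apply: small' => //; have := r0; lra.
  by rewrite lt_min => /andP[].
move=> x t s xr tr sr.
pose B (u : C) := A (x + u *: e) + (- u + - (A 0 + 'd A 0 x)).
have r20 : 0 < 2 * r by rewrite mulr_gt0.
have dB z : nv z <= 2 * (2 * r) -> differentiable B z.
  move=> zr; apply: differentiableD.
    apply: (proj1 (diff_line _)); apply: dA.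
    have : nv (x + z *: e) < m by apply: small' => //; lra.
    by rewrite lt_min => /andP[].
  apply: differentiableD; last exact: differentiable_cst.
  by apply: differentiableN; exact: ex_diff.
have BM z : 2 * r <= nv z <= 2 * (2 * r) -> nv (B z) <= eps * (r * (1 + 4 * nv e)).
  move=> /andP[_ zr]; have zr' : nv z <= 4 * r by lra.
  have : nv (x + z *: e) < d by have := small' x z xr zr'; rewrite lt_min => /andP[].
  move=> /D; rewrite add0r linearD linearZ /= dAe -[z *: 1]/(z * 1) mulr1.
  have -> : A (x + z *: e) - A 0 - ('d A 0 x + z) = B z.
    by rewrite /B; move: (A _) (A 0) ('d A 0 x) => a b c; ring.
  move=> /le_trans; apply; rewrite ler_pM2l //; exact: small.
have t2 : 2 * nv t <= 2 * r by rewrite ler_pM2l.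
have s2 : 2 * nv s <= 2 * r by rewrite ler_pM2l.
have := cauchy_lip r20 dB BM t2 s2.
have -> : B t - B s = A (x + t *: e) - A (x + s *: e) - (t - s).
  by rewrite /B; move: (A _) (A _) (A 0) ('d A 0 x) => a b c c'; ring.
move=> /le_trans; apply; rewrite ler_wpM2r ?nv_ge0 // /eps.
rewrite le_eqVlt; apply/orP; left; apply/eqP; field.
by rewrite !gt_eqF.
Qed.

Section fixed.
Variables (V : normedModType C) (A : V -> C) (e : V) (del r : R).
Hypotheses (r0 : 0 < r) (dA : forall y, nv y < del -> differentiable A y).
Hypothesis ins : forall x (t : C), nv x <= r -> nv t <= r -> nv (x + t *: e) < del.
Hypothesis strict : forall x (t s : C), nv x <= r -> nv t <= r -> nv s <= r ->
  nv (A (x + t *: e) - A (x + s *: e) - (t - s)) <= 2^-1 * nv (t - s).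

Lemma strict_inj x (t s : C) : nv x <= r -> nv t <= r -> nv s <= r ->
  nv (t - s) <= 2 * nv (A (x + t *: e) - A (x + s *: e)).
Proof.
move=> xr tr sr; have := strict xr tr sr; rewrite nvBC.
have := nv_lipB (t - s) (A (x + t *: e) - A (x + s *: e)); lra.
Qed.

Lemma strict_injN x (t s : C) : nv x <= r -> nv t <= r -> nv s <= r ->
  nv (t - s) <= 2 * nv (A (x - t *: e) - A (x - s *: e)).
Proof.
move=> xr; rewrite -(nvN t) -(nvN s) => tr sr; have := strict_inj xr tr sr.
by rewrite !scaleNr -opprD nvN.
Qed.

(** The strict estimate says that difference quotients along e are within 1/2
    of 1, which keeps the derivative away from 0. *)
Lemma strict_derive x (t : C) : nv x <= r -> nv t < r ->
  4^-1 <= nv ('d A (x + t *: e) e).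
Proof.
move=> xr tr; set y := x + t *: e; set p := 'd A y e.
have dAy : differentiable A y by apply: dA; apply: ins => //; exact: ltW.
have q0 : 0 < 4^-1 :> R by rewrite invr_gt0.
have e1 : 0 < nv e + 1 by rewrite ltr_wpDl // nv_ge0.
have [d d0 D] := diff_eps dAy (divr_gt0 q0 e1).
pose u := Num.min (d / (2 * (nv e + 1))) (r - nv t).
have u0 : 0 < u by rewrite lt_min subr_gt0 tr divr_gt0 // mulr_gt0.
have u1 : u * (2 * (nv e + 1)) <= d by rewrite -ler_pdivlMr ?mulr_gt0 // ge_min lexx.
have u2 : u <= r - nv t by rewrite ge_min lexx orbT.
have nu : nv (inC u) = u by rewrite nv_inC gtr0_norm.
have ue : nv (inC u *: e) = u * nv e by rewrite nvZ nu.
have ued : u * nv e < d.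
  apply: lt_le_trans u1; rewrite ltr_pM2l //; have := nv_ge0 e; lra.
have tur : nv (t + inC u) <= r by have := nvD t (inC u); rewrite nu; lra.
have lin : 'd A y (inC u *: e) = inC u * p by rewrite linearZ.
have := D (inC u *: e); rewrite ue lin => /(_ ued) h1.
have := strict xr tur (ltW tr); rewrite scalerDl addrA -/y.
have -> : t + inC u - t = inC u by rewrite addrAC subrr add0r.
rewrite nu => h2.
have h3 : 4^-1 / (nv e + 1) * (u * nv e) <= 4^-1 * u.
  rewrite -mulrA ler_pM2l // mulrCA ler_piMr ?(ltW u0) //.
  by rewrite mulrC ler_pdivrMr // mul1r lerDl.
move: h1 h2; set a := A _ - A y => h1 h2.
have : nv (inC u * p) = u * nv p by rewrite nvM nu.
have := nv_lipB (inC u) (a - inC u * p - (a - inC u)).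
have -> : inC u - (a - inC u * p - (a - inC u)) = inC u * p by ring.
have := nvB (a - inC u * p) (a - inC u).
rewrite nu => h4 h5 h6; rewrite h6 in h5.
rewrite -(ler_pM2l u0); lra.
Qed.

(** Without a zero on this line, 1 / A would be holomorphic along it, and the
    maximum estimate would bound 1 / A(x) by the values of 1 / A on the annulus,
    where A is comparable to r; that contradicts the smallness of A(x). *)
Lemma zero_exists x : nv x <= r -> 256 * nv (A x) < r -> exists2 t : C, nv t <= r & A (x + t *: e) = 0.
Proof.
move=> xr Ax; apply: contrapT => nex.
have nz t : nv t <= r -> A (x + t *: e) != 0.
  by move=> tr; apply/eqP => At; apply: nex; exists t.
pose g (t : C) := (A (x + t *: e))^-1.
have r20 : 0 < r / 2 by rewrite divr_gt0.
have rr : 2 * (r / 2) = r by lra.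
have dg z : nv z <= 2 * (r / 2) -> differentiable g z.
  rewrite rr => zr; apply: differentiableV; last exact: nz.
  by apply: (proj1 (diff_line _)); apply: dA; exact: ins.
have x0 : x + (0 : C) *: e = x by rewrite scale0r addr0.
have gM z : r / 2 <= nv z <= 2 * (r / 2) -> nv (g z) <= 8 / r.
  rewrite rr => /andP[z1 zr]; rewrite /g nvV -[8 / r]invf_div lef_pV2 ?posrE ?divr_gt0 ?nv_gt0 ?nz //.
  have n0 : nv (0 : C) <= r by rewrite nv0 ltW.
  have := strict_inj xr zr n0; rewrite x0 subr0.
  have := nvB (A (x + z *: e)) (A x); lra.
have := cauchy_max r20 dg gM; rewrite /g x0 nvV.
have Ax0 : 0 < nv (A x) by rewrite nv_gt0 -x0 nz // nv0 ltW.
have : 256 / r < (nv (A x))^-1 by rewrite ltr_pdivrMr // mulrC ltr_pdivlMr.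
lra.
Qed.

End fixed.

Section solution.
Variables (n : nat).
Local Notation V := 'rV[C]_n.

(** The solution is Lipschitz by the strict estimate, and then its
    differential is forced by the equation A(x - psi(x) e) = 0. The last clause
    is the quantitative uniqueness of the zero. *)
Theorem implicit_function (A : V -> C) (e : V) :
  (\forall y \near 0, differentiable A y) -> A 0 = 0 -> 'd A 0 e = 1 ->
  exists (psi : V -> C) (d r : R), [/\ 0 < d, 0 < r,
    forall x, nv x < d -> [/\ A (x - psi x *: e) = 0, nv (psi x) <= 2 * nv (A x) &
                            differentiable psi x] &
    (forall y, nv y < d -> differentiable A y) /\
    forall x (t : C), nv x < d -> nv t <= r -> 4^-1 * nv (t - psi x) <= nv (A (x - t *: e))].
Proof.
move=> /nearP[del del0 dA'] A0 dAe.
have dA y : nv y < del -> differentiable A y by move=> /dA'; rewrite add0r.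
have [r r0 [ins strict]] := strict_estimate del0 dA dAe.
have cA : {for 0, continuous A} by apply: differentiable_continuous; apply: dA; rewrite nv0.
have r256 : 0 < r / 256 by have := r0; lra.
have [d0 d00 D0] := (contP _ _).1 cA _ r256.
pose d := Num.min d0 (Num.min r del).
have dp : 0 < d by rewrite !lt_min d00 r0.
have dle x : nv x < d -> [/\ nv x <= r, nv x < del & 256 * nv (A x) < r].
  rewrite !lt_min => /andP[/D0]; rewrite add0r A0 subr0 => h /andP[/ltW h1 h2].
  by split=> //; lra.
have /choice[psi psiP] : forall x, exists t : C, nv x < d -> nv t <= r /\ A (x - t *: e) = 0.
  move=> x; have [xd|nxd] := pselect (nv x < d); last by exists 0 => /nxd.
  have [x1 x2 x3] := dle x xd; have [t tr At] := zero_exists r0 dA ins strict x1 x3.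
  by exists (- t) => _; rewrite nvN scaleNr opprK.
have psi2 x : nv x < d -> nv (psi x) <= 2 * nv (A x).
  move=> xd; have [p1 p2] := psiP x xd; have [x1 x2 x3] := dle x xd.
  have n0 : nv (0 : C) <= r by rewrite nv0 ltW.
  have := strict_injN strict x1 p1 n0.
  by rewrite p2 scale0r !subr0 sub0r nvN.
have psir x : nv x < d -> nv (psi x) < r.
  move=> xd; have := psi2 x xd; have [x1 x2 x3] := dle x xd; lra.
exists psi, d, r; split; [exact: dp|exact: r0| |]; last first.
  split=> [y /dle[_ yd _]|x t xd tr]; first exact: dA.
  have [p1 p2] := psiP x xd; have [x1 x2 x3] := dle x xd.
  have := strict_injN strict x1 tr p1; rewrite p2.
  by move: (t - _) => u; rewrite subr0; have := nv_ge0 (A (x - t *: e)); lra.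
move=> x xd; have [p1 p2] := psiP x xd; split; [exact: p2|exact: psi2|].
have [x1 x2 x3] := dle x xd.
pose y := x - psi x *: e; pose p := 'd A y e.
have pp : 4^-1 <= nv p.
  have := @strict_derive _ A e del r dA ins strict x (- psi x) x1.
  by rewrite nvN scaleNr; apply; exact: psir.
have dAy : differentiable A y.
  by apply: dA; rewrite /y -scaleNr; apply: ins => //; rewrite nvN.
have [B B0 BP] := diff_bounded dAy.
(* K is a Lipschitz constant for psi near x. *)
pose K := 2 * (B + 1); have K0 : 0 < K by rewrite mulr_gt0 // ltr_wpDl // ltW.
have Ke : 0 < 1 + K * nv e by rewrite ltr_pwDl // mulr_ge0 ?nv_ge0 // ltW.
have linL : linear (fun v => p^-1 * 'd A y v).
  by move=> k u v; rewrite linearP mulrDr /GRing.scale /= mulrCA.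
have : is_diff x psi (fun v => p^-1 * 'd A y v); last by move=> h; exact: ex_diff.
apply: row_is_diff => // eps eps0.
have e40 : 0 < eps / 4 / (1 + K * nv e) by rewrite !divr_gt0.
have [d1 d10 D1] := diff_eps dAy e40; have [d2 d20 D2] := diff_eps dAy ltr01.
exists (Num.min (Num.min d2 (d1 / (1 + K * nv e))) (d - nv x)).
  by rewrite !lt_min d20 divr_gt0 // subr_gt0.
move=> v; rewrite !lt_min ltr_pdivlMr // => /andP[/andP[vd2 vd1] vd].
have xvd : nv (x + v) < d by have := nvD x v; lra.
have [y1 y2 y3] := dle _ xvd; have [q1 q2] := psiP _ xvd.
set D := psi (x + v) - psi x.
have DK : nv D <= K * nv v.
  have := strict_injN strict y1 q1 p1; rewrite q2 -/D addrAC -/y sub0r nvN.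
  have := D2 v vd2; rewrite p2 subr0 mul1r.
  have := nvD (A (y + v) - 'd A y v) ('d A y v); rewrite subrK.
  have := BP v; rewrite /K; lra.
pose w := v - D *: e.
have yw : y + w = x + v - psi (x + v) *: e.
  by rewrite /y /w /D scalerBl opprB addrA [x - _ + v]addrAC addrA subrK.
have wv : nv w <= (1 + K * nv e) * nv v.
  apply: le_trans (nvB _ _) _; rewrite nvZ mulrDl mul1r lerD2l mulrAC.
  by rewrite ler_wpM2r ?nv_ge0.
have wd1 : nv w < d1 by apply: le_lt_trans wv _; rewrite mulrC.
have := D1 w wd1; rewrite yw q2 p2 subrr sub0r nvN linearB linearZ -/p => h.
have pn0 : p != 0 by rewrite -nv_gt0; apply: lt_le_trans pp; rewrite invr_gt0.
have -> : D - p^-1 * 'd A y v = - (p^-1 * ('d A y v - D * p)).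
  by move: ('d A y v) => a; field.
rewrite nvN nvM nvV -ler_pdivlMl ?invr_gt0 ?nv_gt0 // invrK.
apply: le_trans h _; apply: le_trans (_ : eps / 4 * nv v <= _).
  rewrite -mulrA ler_pM2l ?divr_gt0 // ler_pdivrMl //.
have -> : eps / 4 * nv v = 4^-1 * (eps * nv v) by ring.
by apply: ler_wpM2r => //; rewrite mulr_ge0 ?nv_ge0 // ltW.
Qed.
End solution.
End Implicit.

(** * Division by a function with nonzero differential *)

Section Division.
Variable R : realType.
Local Notation C := (complexes R).
Local Notation inC := (@inC R).
Variable n : nat.
Local Notation V := 'rV[C]_n.

Lemma near_bounded (V' : normedModType C) (f : V' -> C) (x : V') : differentiable f x ->
  exists2 d, 0 < d & forall v, nv v < d -> nv (f (x + v)) <= nv (f x) + 1.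
Proof.
move=> /differentiable_continuous /contP /(_ _ ltr01) [d d0 H]; exists d => // v /H h.
have := nvD (f (x + v) - f x) (f x); rewrite subrK; lra.
Qed.

Section fixed.
Variables (A f psi : V -> C) (e : V) (d r M : R).
Hypotheses (d0 : 0 < d) (r0 : 0 < r).
Hypothesis dA : forall y, nv y < d -> differentiable A y.
Hypothesis df : forall y, nv y < d -> differentiable f y.
Hypothesis AM : forall y, nv y < d -> nv (A y) <= M.
Hypothesis fM : forall y, nv y < d -> nv (f y) <= M.
Hypothesis psi_le : forall x, nv x < d -> nv (psi x) <= 2 * nv (A x).
Hypothesis low : forall x (t : C), nv x < d -> nv t <= r ->
  4^-1 * nv (t - psi x) <= nv (A (x - t *: e)).
Hypothesis f0 : forall x, nv x < d -> A x = 0 -> f x = 0.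

(** On the zero locus, the limit of f / A along e, by l'Hopital's rule. *)
Definition quot (x : V) : C := if A x == 0 then 'd f x e / 'd A x e else f x / A x.

Lemma psi0 y : nv y < d -> A y = 0 -> psi y = 0.
Proof.
move=> yd Ay; apply/eqP; rewrite -nv_eq0 eq_le nv_ge0 andbT.
by have := psi_le yd; rewrite Ay nv0 mulr0.
Qed.

Lemma low0 y (t : C) : nv y < d -> A y = 0 -> nv t <= r -> 4^-1 * nv t <= nv (A (y + t *: e)).
Proof.
move=> yd Ay tr; have := @low y (- t) yd; rewrite nvN => /(_ tr).
by rewrite (psi0 yd Ay) subr0 nvN scaleNr opprK.
Qed.

Lemma quot_diff y : nv y < d -> A y != 0 -> differentiable quot y.
Proof.
move=> yd Ay; have Ap : 0 < nv (A y) by rewrite nv_gt0.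
have cA : {for y, continuous A} by apply: differentiable_continuous; exact: dA.
have [d1 d10 D1] := (contP _ _).1 cA _ Ap.
apply: (diff_near_eq (f := fun x => f x * (A x)^-1) d10).
  move=> v /D1 h; rewrite /quot; case: eqP => // A0.
  by move: h; rewrite A0 sub0r nvN ltxx.
by apply: differentiableM; [exact: df|apply: differentiableV; [exact: dA|exact: Ay]].
Qed.

(** The lower bound on A along e excludes a vanishing derivative. *)
Lemma dAe_neq0 y : nv y < d -> A y = 0 -> 'd A y e != 0.
Proof.
move=> yd Ay; apply/eqP => p0.
have e1 : 0 < nv e + 1 by rewrite ltr_wpDl // nv_ge0.
have e8 : 0 < 8^-1 / (nv e + 1) by rewrite divr_gt0 // invr_gt0.
have [d1 d10 D1] := diff_eps (dA yd) e8.
pose t := Num.min r (d1 / (2 * (nv e + 1))).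
have t0 : 0 < t by rewrite lt_min r0 divr_gt0 // mulr_gt0.
have tr : t <= r by rewrite ge_min lexx.
have td : t * (2 * (nv e + 1)) <= d1 by rewrite -ler_pdivlMr ?mulr_gt0 // ge_min lexx orbT.
have nt : nv (inC t) = t by rewrite nv_inC gtr0_norm.
have te : nv (inC t *: e) = t * nv e by rewrite nvZ nt.
have lin : 'd A y (inC t *: e) = 0 by rewrite linearZ /= p0 [LHS]mulr0.
have := D1 (inC t *: e); rewrite te lin Ay !subr0 => h1.
have ted : t * nv e < d1.
  by apply: lt_le_trans td; rewrite ltr_pM2l //; have := nv_ge0 e; lra.
have := @low0 y (inC t) yd Ay; rewrite nt => /(_ tr).
have := h1 ted.
have : 8^-1 / (nv e + 1) * (t * nv e) <= 8^-1 * t.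
  rewrite -mulrA ler_pM2l ?invr_gt0 // mulrCA ler_piMr ?(ltW t0) //.
  by rewrite mulrC ler_pdivrMr // mul1r lerDl.
have := t0; lra.
Qed.

(** Both f and A vanish to order at least one at t = 0, so both are t times a
    function differentiable there, and the one for A does not vanish. *)
Lemma quot_line0 y : nv y < d -> A y = 0 -> differentiable (fun t : C => quot (y + t *: e)) 0.
Proof.
move=> yd Ay.
have e1 : 0 < nv e + 1 by rewrite ltr_wpDl // nv_ge0.
pose s := Num.min (r / 2) ((d - nv y) / (4 * (nv e + 1))).
have s0 : 0 < s by rewrite lt_min !divr_gt0 // ?subr_gt0 // mulr_gt0.
have sr : s <= r / 2 by rewrite ge_min lexx.
have sd : s * (4 * (nv e + 1)) <= d - nv y by rewrite -ler_pdivlMr ?mulr_gt0 // ge_min lexx orbT.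
have ins (t : C) : nv t <= 2 * s -> nv (y + t *: e) < d.
  move=> ts; have := nvD y (t *: e); rewrite nvZ.
  have : nv t * nv e <= 2 * s * nv e by rewrite ler_wpM2r ?nv_ge0.
  have := s0; lra.
pose G (t : C) := f (y + t *: e); pose a (t : C) := A (y + t *: e).
have y0 : y + (0 : C) *: e = y by rewrite scale0r addr0.
have dG z : nv z <= 2 * s -> differentiable G z.
  by move=> zs; apply: (proj1 (diff_line _)); apply: df; exact: ins.
have da z : nv z <= 2 * s -> differentiable a z.
  by move=> zs; apply: (proj1 (diff_line _)); apply: dA; exact: ins.
have GM z : s <= nv z <= 2 * s -> nv (G z) <= M.
  by move=> /andP[_ zs]; apply: fM; exact: ins.
have aM z : s <= nv z <= 2 * s -> nv (a z) <= M.
  by move=> /andP[_ zs]; apply: AM; exact: ins.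
have G0 : G 0 = 0 by rewrite /G y0; exact: f0.
have a0 : a 0 = 0 by rewrite /a y0.
have qG := removable s0 dG GM G0; have qa := removable s0 da aM a0.
have dy0 (g : V -> C) : differentiable g y -> 'd (fun t : C => g (y + t *: e)) 0 1 = 'd g y e.
  by move=> dg; have [] := @diff_line _ _ _ g y e 0; rewrite y0.
have [p [q [Ep Eq]]] : exists p q, p = 'd f y e /\ q = 'd A y e.
  by exists ('d f y e), ('d A y e).
have EG : 'd G 0 1 = p by rewrite Ep; apply: dy0; exact: df.
have Ea : 'd a 0 1 = q by rewrite Eq; apply: dy0; exact: dA.
have qy : quot y = p / q by rewrite /quot Ay eqxx Ep Eq.
have q0 : q != 0 by rewrite Eq; exact: dAe_neq0.
rewrite EG in qG; rewrite Ea in qa.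
apply: (diff_near_eq (f := fun t : C => (if t == 0 then p else G t / t) *
   (if t == 0 then q else a t / t)^-1) s0); last first.
  apply: differentiableM; first exact: qG.
  by apply: differentiableV; [exact: qa|rewrite eqxx].
move=> t ts; rewrite add0r; case: eqVneq => [->|t0]; first by rewrite y0 qy.
have tr : nv t <= r by lra.
have an : a t != 0.
  have tp : 0 < nv t by rewrite nv_gt0.
  by rewrite -nv_gt0; apply: lt_le_trans (low0 yd Ay tr); lra.
have -> : quot (y + t *: e) = G t / a t by rewrite /quot (negbTE an).
by move: (G t) (a t) an => u v vn; field; rewrite t0 vn.
Qed.

Lemma quot_line x (t : C) : nv (x + t *: e) < d -> differentiable (fun t : C => quot (x + t *: e)) t.
Proof.
move=> yd; have [Ay|Ay] := eqVneq (A (x + t *: e)) 0; last first.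
  by apply: (proj1 (diff_line _)); exact: quot_diff.
have -> : (fun s : C => quot (x + s *: e)) =
    (fun u : C => quot (x + t *: e + u *: e)) \o (fun s : C => s - t).
  by apply/funext => s /=; rewrite -addrA -scalerDl [t + _]addrC subrK.
apply: differentiable_comp; last by rewrite subrr; exact: quot_line0.
by apply: differentiableB; [exact: ex_diff|exact: differentiable_cst].
Qed.

Lemma quot_hol z : nv z < d -> differentiable quot z.
Proof.
move=> zd; have [Az|] := eqVneq (A z) 0; last exact: quot_diff.
have e1 : 0 < nv e + 1 by rewrite ltr_wpDl // nv_ge0.
pose w := (d - nv z) / 2; have w0 : 0 < w by rewrite divr_gt0 // subr_gt0.
pose s := Num.min (r / 2) (w / (4 * (nv e + 1))).
have we : 0 < w / (4 * (nv e + 1)) by apply: divr_gt0 => //; apply: mulr_gt0.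
have s0 : 0 < s by rewrite lt_min we divr_gt0.
have sr : s <= r / 2 by rewrite ge_min lexx.
have sd : s * (4 * (nv e + 1)) <= w by rewrite -ler_pdivlMr ?mulr_gt0 // ge_min lexx orbT.
have cA : {for z, continuous A} by apply: differentiable_continuous; exact: dA.
have s4 : 0 < s / 4 by rewrite divr_gt0.
have [d1 d10 D1] := (contP _ _).1 cA _ s4.
pose rho := Num.min (d1 / 3) (w / 4).
have w4 : 0 < w / 4 by apply: divr_gt0.
have rho0 : 0 < rho by rewrite lt_min w4 divr_gt0.
have rho1 : rho <= d1 / 3 by rewrite ge_min lexx.
have rho2 : rho <= w / 4 by rewrite ge_min lexx orbT.
have wE : w + w = d - nv z by rewrite /w; lra.
have ins v (t : C) : nv v <= 2 * rho -> nv t <= 2 * s -> nv (z + v + t *: e) < d.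
  move=> vr ts; have := nvD (z + v) (t *: e); have := nvD z v; rewrite nvZ.
  have : nv t * nv e <= 2 * s * nv e by rewrite ler_wpM2r ?nv_ge0.
  have := s0; have := w0; clear -vr rho2 sd wE ts; lra.
apply: (@hartogs_line _ _ quot z e s rho (M * (8 / s)) s0 rho0).
  move=> t v /andP[ts1 ts2] vr; rewrite addrAC.
  have zvd : nv (z + v) < d.
    by have := @ins v 0 vr; rewrite scale0r addr0 nv0; apply; rewrite mulr_ge0 // ltW.
  have Azv : nv (A (z + v)) < s / 4.
    by have := D1 v; rewrite Az subr0; apply; lra.
  (* On the annulus, - t is at distance at least s / 2 from the zero psi (z + v). *)
  have ld : s / 8 <= nv (A (z + v + t *: e)).
    have := @low (z + v) (- t) zvd; rewrite nvN scaleNr opprK => /(_ _) h.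
    have {}h : 4^-1 * nv (- t - psi (z + v)) <= nv (A (z + v + t *: e)) by apply: h; lra.
    have := psi_le zvd; have := nv_lipB (- t) (psi (z + v)); rewrite nvN.
    lra.
  have Ap : 0 < nv (A (z + v + t *: e)) by apply: lt_le_trans ld; rewrite divr_gt0.
  have An : A (z + v + t *: e) != 0 by rewrite -nv_gt0.
  have yd := ins v t vr ts2.
  split; first exact: quot_diff.
  rewrite /quot (negbTE An) nvM nvV; apply: ler_pM; rewrite ?invr_ge0 ?nv_ge0 ?fM //.
  by rewrite -[8 / s]invf_div lef_pV2 // posrE divr_gt0.
move=> v t vr ts; apply: quot_line; apply: ins => //; have := rho0; lra.
Qed.
End fixed.

Theorem division (A f : V -> C) (e : V) :
  (\forall y \near (0 : V), differentiable A y) -> A 0 = 0 -> 'd A 0 e = 1 ->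
  (\forall y \near (0 : V), differentiable f y) ->
  (\forall y \near (0 : V), A y = 0 -> f y = 0) ->
  exists2 h : V -> C, \forall y \near (0 : V), differentiable h y & \forall y \near (0 : V), f y = A y * h y.
Proof.
move=> hA A0 dAe hf f0.
have [psi [d [r [d0 r0 psiP [dA low]]]]] := implicit_function hA A0 dAe.
move: hf f0 => /nearP[d1 d10 df] /nearP[d2 d20 f0].
have dA0 : differentiable A 0 by apply: dA; rewrite nv0.
have df0 : differentiable f 0 by have := df 0; rewrite addr0 nv0; apply.
have [d3 d30 AM] := near_bounded dA0; have [d4 d40 fM] := near_bounded df0.
pose M := nv (A 0) + 1 + (nv (f 0) + 1).
pose D := Num.min d (Num.min (Num.min d1 d2) (Num.min d3 d4)).
have D0 : 0 < D by rewrite !lt_min d0 d10 d20 d30 d40.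
have DP (y : V) : nv y < D -> [/\ nv y < d, nv y < d1, nv y < d2, nv y < d3 & nv y < d4].
  by rewrite !lt_min => /andP[? /andP[/andP[? ?] /andP[? ?]]].
have q : forall z, nv z < D -> differentiable (quot A f e) z.
  apply: (@quot_hol A f psi e D r M r0).
  - by move=> y /DP[? _ _ _ _]; exact: dA.
  - by move=> y /DP[_ yd _ _ _]; have := df y yd; rewrite add0r.
  - move=> y /DP[_ _ _ yd _]; have := AM y yd; rewrite add0r /M; have := nv_ge0 (f 0); lra.
  - move=> y /DP[_ _ _ _ yd]; have := fM y yd; rewrite add0r /M; have := nv_ge0 (A 0); lra.
  - by move=> x /DP[xd _ _ _ _]; case: (psiP x xd).
  - by move=> x t /DP[xd _ _ _ _]; exact: low.
  - by move=> x /DP[_ _ xd _ _]; have := f0 x xd; rewrite add0r.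
exists (quot A f e); apply/nearP; exists D; [exact: D0| |exact: D0|] => v vD; rewrite add0r; first exact: q.
rewrite /quot; case: eqP => [Av|/eqP Av].
  by rewrite Av mul0r; have [_ _ vd _ _] := DP v vD; have := f0 v vd; rewrite add0r; apply.
by rewrite mulrC divfK.
Qed.

Theorem retraction (A : V -> C) (e : V) :
  (\forall y \near (0 : V), differentiable A y) -> A 0 = 0 -> 'd A 0 e = 1 ->
  exists psi : V -> C, [/\ \forall x \near (0 : V), differentiable psi x, psi 0 = 0,
    \forall x \near (0 : V), A (x - psi x *: e) = 0 & \forall x \near (0 : V), A x = 0 -> psi x = 0].
Proof.
move=> hA A0 dAe.
have [psi [d [r [d0 r0 psiP [dA low]]]]] := implicit_function hA A0 dAe.
have n0 : nv (0 : V) < d by rewrite nv0.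
have p0 (x : V) : nv x < d -> A x = 0 -> psi x = 0.
  move=> xd Ax; apply/eqP; rewrite -nv_eq0 eq_le nv_ge0 andbT.
  by have [_ + _] := psiP x xd; rewrite Ax nv0 mulr0.
exists psi; split.
- apply/nearP; exists d; [exact: d0|move=> v vd; rewrite add0r; have [_ _ h] := psiP v vd; exact: h].
- exact: (p0 0 n0 A0).
- apply/nearP; exists d; [exact: d0|move=> v vd; rewrite add0r; have [h _ _] := psiP v vd; exact: h].
- apply/nearP; exists d; [exact: d0|move=> v vd; rewrite add0r; exact: p0].
Qed.

(** On a line parallel to e the zeros of A are isolated, so f vanishes at
    points arbitrarily close to any given one. *)
Theorem torsion_free (A f : V -> C) (e : V) :
  (\forall y \near (0 : V), differentiable A y) -> A 0 = 0 -> 'd A 0 e = 1 ->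
  (\forall y \near (0 : V), differentiable f y) -> (\forall y \near (0 : V), A y * f y = 0) ->
  \forall y \near (0 : V), f y = 0.
Proof.
move=> hA A0 dAe /nearP[d1 d10 df] /nearP[d2 d20 Af].
have [psi [d [r [d0 r0 psiP [dA low]]]]] := implicit_function hA A0 dAe.
apply/nearP; exists (Num.min d (Num.min d1 d2)); first by rewrite !lt_min d0 d10.
move=> x; rewrite add0r !lt_min => /andP[xd /andP[xd1 xd2]].
have [Ax|Ax] := eqVneq (A x) 0; last first.
  by have := Af x xd2; rewrite add0r => /eqP; rewrite mulf_eq0 (negbTE Ax) => /eqP.
have px : psi x = 0.
  apply/eqP; rewrite -nv_eq0 eq_le nv_ge0 andbT.
  by have [_ + _] := psiP x xd; rewrite Ax nv0 mulr0.
have e1 : 0 < nv e + 1 by rewrite ltr_wpDl // nv_ge0.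
apply/eqP; apply: contrapT => /negP fx; have fp : 0 < nv (f x) by rewrite nv_gt0.
have cf : {for x, continuous f}.
  by apply: differentiable_continuous; have := df x xd1; rewrite add0r.
have [d3 d30 D3] := (contP _ _).1 cf _ fp.
pose w := Num.min d3 (d2 - nv x); have w0 : 0 < w by rewrite lt_min d30 subr_gt0.
pose t := Num.min r (w / (2 * (nv e + 1))).
have t0 : 0 < t by rewrite lt_min r0 divr_gt0 // mulr_gt0.
have tr : t <= r by rewrite ge_min lexx.
have td : t * (2 * (nv e + 1)) <= w by rewrite -ler_pdivlMr ?mulr_gt0 // ge_min lexx orbT.
have nt : nv (inC t) = t by rewrite nv_inC gtr0_norm.
have tew : t * nv e < w.
  by apply: lt_le_trans td; rewrite ltr_pM2l //; have := nv_ge0 e; lra.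
move: tew; rewrite lt_min => /andP[te3 te2].
have te : nv (- (inC t *: e)) = t * nv e by rewrite nvN nvZ nt.
have := D3 (- (inC t *: e)); rewrite te => /(_ te3).
have := low x (inC t) xd; rewrite nt px subr0 nt => /(_ tr) l.
have An : A (x - inC t *: e) != 0 by rewrite -nv_gt0; apply: lt_le_trans l; rewrite mulr_gt0 ?invr_gt0.
have := Af (x - inC t *: e); rewrite add0r => /(_ _)/eqP.
have -> : nv (x - inC t *: e) < d2 by have := nvD x (- (inC t *: e)); rewrite te; lra.
by move=> /(_ isT); rewrite mulf_eq0 (negbTE An) => /eqP ->; rewrite sub0r nvN ltxx.
Qed.

End Division.

(** * Contraction in the exterior algebra *)

Section Exterior.
Variables (K : comNzRingType) (n : nat).
Implicit Types (I J : {set 'I_n}) (i j l : 'I_n) (a b w : ext K n).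
Local Notation sgn := (shuffle_sign K).

(** The number of transpositions that put dz_i in its place in dz_i /\ dz_J. *)
Definition below i J : nat := #|[set j in J | (j < i)%N]%SET|.

Lemma shuffle_sign1 i J : sgn [set i]%SET J = (-1) ^+ below i J.
Proof.
rewrite /shuffle_sign /below; congr (_ ^+ _).
rewrite -(card_imset _ (can_inj (fun j => erefl : (i, j).2 = j))).
apply: eq_card => -[x y]; rewrite !inE /=; apply/idP/imsetP.
  by case/and3P=> /eqP -> yJ yi; exists y; rewrite // inE yJ.
by case=> j; rewrite inE => /andP[jJ ji] [-> ->]; rewrite eqxx jJ.
Qed.

Definition one_form w := forall I, #|I| != 1 -> w I = 0.

Lemma wedge1 w a J : one_form w ->
  wedge w a J = \sum_(i in J) (-1) ^+ below i (J :\ i) * w [set i]%SET * a (J :\ i)%SET.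
Proof.
move=> w1; rewrite ffunE; pose S := [set [set i]%SET | i in J]%SET.
(* Only the singletons contribute, w being of degree one. *)
rewrite (bigID [in S]) /= [X in _ + X]big1 ?addr0; last first.
  move=> I /andP[IJ /imsetP IS]; rewrite w1 ?mulr0 ?mul0r //.
  apply/negP => /cards1P[i Ii]; apply: IS; exists i => //.
  by move: IJ; rewrite Ii finset.sub1set.
rewrite (eq_bigl [in S]); last first.
  move=> I /=; rewrite andb_idl // => /imsetP[i iJ ->]; by rewrite finset.sub1set.
rewrite big_imset /=; last by move=> i j _ _; exact: finset.set1_inj.
by apply: eq_bigr => i _; rewrite shuffle_sign1.
Qed.

Lemma below_D1 i j J : j \in J -> below i J = ((j < i) + below i (J :\ j))%N.
Proof.
move=> jJ; rewrite /below (cardsD1 j) inE jJ; congr (_ + _)%N.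
by apply: eq_card => x; rewrite !inE andbA.
Qed.

Lemma below_U1 i j J : j \notin J -> below i (j |: J) = ((j < i) + below i J)%N.
Proof. by move=> jJ; rewrite (@below_D1 i j) ?finset.setU11 // finset.setU1K. Qed.

Definition ext_contract l a : ext K n :=
  [ffun I : {set 'I_n} => if l \in I then 0 else (-1) ^+ below l I * a (l |: I)%SET].

Lemma sign_sq m (x : K) : (-1) ^+ m * ((-1) ^+ m * x) = x.
Proof. by rewrite mulrA -exprD addnn -signr_odd odd_double mul1r. Qed.

Lemma ltn_ord_neq i j : i != j -> (i < j)%N = ~~ (j < i)%N.
Proof. by move=> ij; rewrite -leqNgt ltn_neqAle; move: ij; rewrite -val_eqE => ->. Qed.

Lemma signN1 i j : i != j -> (-1) ^+ (i < j)%N = - (-1) ^+ (j < i)%N :> K.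
Proof. by move=> ij; rewrite (ltn_ord_neq ij); case: (j < i)%N; rewrite ?expr0 ?expr1 ?opprK. Qed.

(** The terms in which the contraction meets w add up to w_l a. The others
    cancel in pairs: exchanging the positions of dz_l and dz_i changes the sign,
    since exactly one of l < i and i < l holds. *)
Theorem contract_wedge l w a I : one_form w ->
  ext_contract l (wedge w a) I + wedge w (ext_contract l a) I = w [set l]%SET * a I.
Proof.
move=> w1; rewrite [X in X + _]ffunE; case: ifP => lI.
  rewrite add0r (wedge1 _ _ w1) (bigD1 l) //= [X in _ + X]big1 ?addr0; last first.
    move=> i /andP[iI il]; rewrite ffunE !inE lI eq_sym il /=; exact: mulr0.
  rewrite ffunE finset.setD11 finset.setD1K //.
  by have := sign_sq (below l (I :\ l)) 1; move: ((-1) ^+ _) => s ss; ring: ss.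
rewrite !(wedge1 _ _ w1) (bigD1 l) ?finset.setU11 //= finset.setU1K ?lI //.
rewrite mulrDr -addrA.
have -> : (-1) ^+ below l I * ((-1) ^+ below l I * w [set l]%SET * a I) = w [set l]%SET * a I.
  by rewrite -[X in _ * X]mulrA sign_sq.
rewrite -[RHS]addr0; congr (_ + _).
have E : forall i, ((i \in l |: I) && (i != l)) = (i \in I).
  by move=> i; rewrite !inE; case: eqVneq => [->|]; rewrite ?lI ?andbT.
rewrite (eq_bigl _ _ E) mulr_sumr -big_split big1 // => i iI /=.
have il : i != l by apply: contraFneq lI => <-.
have lIi : l \notin (I :\ i)%SET by rewrite !inE lI andbF.
have eU : ((l |: I) :\ i = l |: (I :\ i))%SET.
  by apply/finset.setP => x; rewrite !inE; case: eqVneq => [->|] //=; rewrite (negbTE il).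
rewrite ffunE (negbTE lIi) eU (below_U1 _ lIi) (below_D1 l iI) !exprD (signN1 il).
have := sign_sq (l < i)%N 1; move: ((-1) ^+ (l < i)%N) => s ss; ring: ss.
Qed.

Lemma wedge_linear w b b' x I :
  wedge w [ffun J : {set 'I_n} => b J + x * b' J] I = wedge w b I + x * wedge w b' I.
Proof.
rewrite !ffunE mulr_sumr -big_split; apply: eq_bigr => J _ /=.
by rewrite ffunE mulrDr; congr (_ + _); rewrite mulrCA.
Qed.

Lemma wedge_sum w b I : one_form w -> wedge w (wedge w b) I =
  \sum_(i in I) \sum_(j in I :\ i)
    (-1) ^+ below i (I :\ i) * w [set i]%SET *
     ((-1) ^+ below j (I :\ i :\ j) * w [set j]%SET * b (I :\ i :\ j)%SET).
Proof.
move=> w1; rewrite (wedge1 _ _ w1); apply: eq_bigr => i _.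
by rewrite (wedge1 _ _ w1) mulr_sumr.
Qed.

(** The double sum over (i, j) changes sign when i and j are exchanged. *)
Lemma wedge_wedgeN w b I : one_form w -> wedge w (wedge w b) I = - wedge w (wedge w b) I.
Proof.
move=> w1; rewrite {1}(wedge_sum _ _ w1) (exchange_big_dep [in I]) /=; last first.
  by move=> i j _; rewrite inE => /andP[].
rewrite (wedge_sum _ _ w1) -sumrN; apply: eq_bigr => j jI.
rewrite -sumrN (eq_bigl (fun i => i \in I :\ j)%SET); last first.
  by move=> i; rewrite !inE jI andbT andbC eq_sym.
apply: eq_bigr => i; rewrite !inE => /andP[ij iI].
have ji : j != i by rewrite eq_sym.
have jIi : j \in (I :\ i)%SET by rewrite !inE ji.
have iIj : i \in (I :\ j)%SET by rewrite !inE ij.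
have eD : (I :\ j :\ i = I :\ i :\ j)%SET by apply/finset.setP => x; rewrite !inE andbCA.
rewrite (below_D1 i jIi) (below_D1 j iIj) eD !exprD (signN1 ij).
ring.
Qed.

Lemma contract_degree (k : int) l a : (forall I, #|I|%:Z != k -> a I = 0) ->
  forall I, #|I|%:Z != k - 1 -> ext_contract l a I = 0.
Proof.
move=> ak I Ik; rewrite ffunE; case: ifP => // lI.
rewrite ak ?mulr0 //; apply: contraNneq Ik => <-; rewrite cardsU1 lI.
by rewrite PoszD addrC addKr.
Qed.

Lemma wedgeZ w b x I : wedge w [ffun J : {set 'I_n} => x * b J] I = x * wedge w b I.
Proof.
rewrite !ffunE mulr_sumr; apply: eq_bigr => J _; rewrite ffunE; exact: mulrCA.
Qed.

Lemma wedge0 w b I : (forall J, b J = 0) -> wedge w b I = 0.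
Proof. by move=> b0; rewrite ffunE big1 // => J _; rewrite b0 mulr0. Qed.

Lemma wedge_degree (k : int) w b : one_form w -> (forall I, #|I|%:Z != k - 1 -> b I = 0) ->
  forall I, #|I|%:Z != k -> wedge w b I = 0.
Proof.
move=> w1 bk I Ik; rewrite (wedge1 _ _ w1) big1 // => i iI; rewrite bk ?mulr0 //.
apply: contraNneq Ik => Ii; rewrite (cardsD1 i) iI PoszD Ii; apply/eqP.
by rewrite addrC subrK.
Qed.

End Exterior.

(** * Linear parts of one-forms *)

Section Forms.
Variables (R : realType) (n : nat).
Local Notation C := (complexes R).
Local Notation V := 'rV[C]_n.

Lemma diff_bigsum (T : Type) (s : seq T) (P : pred T) (F : T -> V -> C) (z : V) :
  (forall i, differentiable (F i) z) ->
  differentiable (fun y => \sum_(i <- s | P i) F i y) z.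
Proof.
move=> dF; elim: s => [|i s IH].
  have -> : (fun y => \sum_(i <- [::] | P i) F i y) = cst 0.
    by apply/funext => y; rewrite big_nil.
  exact: differentiable_cst.
have -> : (fun y => \sum_(j <- i :: s | P j) F j y) =
    (fun y => (if P i then F i y else 0) + \sum_(j <- s | P j) F j y).
  by apply/funext => y; rewrite big_cons; case: (P i); rewrite ?add0r.
apply: differentiableD; last exact: IH.
by case: (P i); [exact: dF|exact: differentiable_cst].
Qed.

Definition smooth_at (a : diff_form R n) (z : V) :=
  forall I, differentiable (fun y => a y I : C) z.

Lemma smooth_wedge a b z : smooth_at a z -> smooth_at b z ->
  smooth_at (wedge_form a b) z.
Proof.
move=> da db I.
have -> : (fun y => wedge_form a b y I : C) = (fun y => \sum_(J : {set 'I_n} | J \subset I)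
     shuffle_sign C J (I :\: J) * a y J * b y (I :\: J)%SET).
  by apply/funext => y; rewrite /wedge_form ffunE.
apply: diff_bigsum => J; apply: differentiableM; last exact: db.
by apply: differentiableM; [exact: differentiable_cst|exact: da].
Qed.

Lemma smooth_contract l a z : smooth_at a z -> smooth_at (fun y => ext_contract l (a y)) z.
Proof.
move=> da I; have [lI|lI] := boolP (l \in I).
  have -> : (fun y => ext_contract l (a y) I : C) = cst 0.
    by apply/funext => y; rewrite ffunE lI.
  exact: differentiable_cst.
have -> : (fun y => ext_contract l (a y) I : C) =
    (fun y => (-1) ^+ below l I * a y (l |: I)%SET).
  by apply/funext => y; rewrite ffunE (negbTE lI).
by apply: differentiableM; [exact: differentiable_cst|exact: da].
Qed.

Lemma smooth_comp a (rho : V -> V) z : differentiable rho z -> smooth_at a (rho z) ->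
  smooth_at (a \o rho) z.
Proof. by move=> dr da I; apply: (differentiable_comp dr (da I)). Qed.

Lemma row_differentiable (V' : normedModType C) m (F : V' -> 'rV[C]_m) (z : V') :
  (forall l, differentiable (fun y => F y 0 l) z) -> differentiable F z.
Proof.
move=> dF; have -> : F = \sum_(l < m) (fun y => F y 0 l *: (delta_mx 0 l : 'rV[C]_m)).
  by apply/funext => y; rewrite fct_sumE [LHS]row_sum_delta.
by apply: differentiable_sum => l; apply: differentiableZl.
Qed.

Lemma diff_coord (V' : normedModType C) m (F : V' -> 'rV[C]_m) (z v : V') l :
  differentiable F z -> 'd (fun y => F y 0 l) z v = 'd F z v 0 l.
Proof.
move=> dF; have lc : linear (fun N : 'rV[C]_m => N 0 l) by move=> k a b; rewrite !mxE.
have [L LE] := linear_pack lc.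
have cL : continuous L by rewrite LE; exact: coord_continuous.
have -> : (fun y => F y 0 l) = L \o F by rewrite LE.
rewrite (diff_comp dF (linear_differentiable _ cL)) /= (diff_lin _ cL).
by rewrite LE.
Qed.

Lemma dual_field_diff w z : smooth_at w z -> differentiable (dual_field w) z.
Proof.
move=> dw; apply: row_differentiable => l.
have -> : (fun y => dual_field w y 0 l) = (fun y => w y [set l]%SET).
  by apply/funext => y; rewrite mxE.
exact: dw.
Qed.

Lemma diff_dual_field w z v l : smooth_at w z ->
  'd (fun y => w y [set l]%SET : C) z v = 'd (dual_field w) z v 0 l.
Proof.
move=> dw; rewrite -(diff_coord v l (dual_field_diff dw)).
by congr ('d _ z v); apply/funext => y; rewrite mxE.
Qed.

Lemma mul_jacobian (F : V -> V) (z v : V) : v *m jacobian F z = 'd F z v.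
Proof. exact: mul_rV_lin1. Qed.

(** A nonzero entry of the Jacobian matrix is a partial derivative of a
    coefficient; e is the corresponding basis vector, rescaled. *)
Lemma rank_gt0_coef w : smooth_at w 0 -> (0 < linear_part_rank w)%N ->
  exists l e, 'd (fun y => w y [set l]%SET : C) 0 e = 1.
Proof.
move=> dw; rewrite /linear_part_rank lt0n mxrank_eq0 => /matrix0Pn[i [l Jil]].
pose v : V := delta_mx 0 i.
have vJ : 'd (dual_field w) 0 v 0 l = jacobian (dual_field w) 0 i l.
  by rewrite -mul_jacobian -rowE mxE.
exists l, ((jacobian (dual_field w) 0 i l)^-1 *: v).
rewrite linearZ /= (diff_dual_field v l dw) vJ; exact: mulVf.
Qed.

(** The differential of x - psi(x) e at 0 is the identity minus a map of rank
    at most one, and the Jacobian matrix of the composite is a product. *)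
Lemma rank_retract w (psi : V -> C) (e : V) : smooth_at w 0 -> differentiable psi 0 ->
  psi 0 = 0 ->
  (linear_part_rank w <= (linear_part_rank (w \o (fun x : V => x - psi x *: e)%R)).+1)%N.
Proof.
move=> dw dpsi psi0; set rho := fun x => _.
have rho0 : rho 0 = 0 by rewrite /rho psi0 scale0r subr0.
have drho : differentiable rho 0.
  by apply: differentiableB; [exact: ex_diff|exact: (differentiableZl e dpsi)].
have dX : differentiable (dual_field w) (rho 0) by rewrite rho0; exact: dual_field_diff.
have drv v : 'd rho 0 v = v - 'd psi 0 v *: e.
  have dpe : differentiable (fun x : V => psi x *: e) 0 := differentiableZl e dpsi.
  have E : rho = (fun x : V => x) - (fun x : V => psi x *: e).
    by apply/funext => x; rewrite fctE.
  have did : differentiable (fun x : V => x) 0 by exact: ex_diff.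
  have dB := diffB did dpe.
  have di : 'd (fun x : V => x) 0 = id :> (V -> V).
    by apply: (@diff_lin _ V V idfun) => x; exact: cont_id.
  have := congr1 (fun g : V -> V => g v) dB; rewrite -E => ->.
  have h1 := congr1 (fun g : V -> V => g v) di.
  have h2 := congr1 (fun g : V -> V => g v) (diffZl e dpsi).
  by congr (_ - _); [exact: h1|exact: h2].
have JE : jacobian (dual_field (w \o rho)) 0 = jacobian rho 0 *m jacobian (dual_field w) 0.
  apply/row_matrixP => i; rewrite [LHS]rowE [RHS]rowE mulmxA [LHS]mul_jacobian.
  rewrite (mul_jacobian rho) (mul_jacobian (dual_field w)).
  have := congr1 (fun g : V -> V => g (delta_mx 0 i)) (diff_comp drho dX).
  by rewrite rho0.
have Jr : jacobian rho 0 = 1%:M + (- (\col_i 'd psi 0 (delta_mx 0 i))) *m e.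
  apply/row_matrixP => i; rewrite [LHS]rowE [RHS]rowE mul_jacobian drv mulmxDr mulmx1.
  rewrite mulmxA mulmxN mulNmx -rowE; congr (_ - _).
  rewrite [row i _]mx11_scalar mul_scalar_mx; congr (_ *: _).
  by rewrite !mxE.
have r1 : (n <= (\rank (jacobian rho 0%R)).+1)%N.
  rewrite -{1}(mxrank1 C n).
  have -> : 1%:M = jacobian rho 0 + (\col_i 'd psi 0 (delta_mx 0 i)) *m e.
    by rewrite Jr mulNmx subrK.
  apply: leq_trans (mxrank_add _ _) _; rewrite -[leqRHS]addn1 leq_add2l.
  exact: leq_trans (mxrankM_maxr _ _) (rank_leq_row _).
rewrite /linear_part_rank JE.
have arith (m a b c : nat) : (m <= a.+1)%N -> (a + b - m <= c)%N -> (b <= c.+1)%N.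
  rewrite leq_subLR => h1 h2; rewrite -(leq_add2l a); apply: leq_trans h2 _.
  by rewrite addnS -addSn leq_add2r.
exact: (arith _ _ _ _ r1 (mxrank_mul_min _ _)).
Qed.
End Forms.

(** * Division of germs of forms *)

Section Main.
Variables (R : realType) (n : nat).
Local Notation C := (complexes R).
Local Notation V := 'rV[C]_n.
Implicit Types (w a b : diff_form R n).

Definition of_degree (k : int) (x : ext C n) := forall I : {set 'I_n}, #|I|%:Z != k -> x I = 0.

Lemma holoP (k : int) a : holomorphic_form k a <->
  \forall z \near (0 : V), smooth_at a z /\ of_degree k (a z).
Proof.
split; apply: filterS => z H.
  by split=> I; [exact: (proj1 (H I))|exact: (proj2 (H I))].
by move=> I; split; [exact: (proj1 H I)|exact: (proj2 H I)].
Qed.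

Lemma one_formP (x : ext C n) : of_degree 1 x -> one_form x.
Proof. by move=> h I I1; apply: h. Qed.

Lemma smooth0 (k : int) a : holomorphic_form k a -> smooth_at a 0.
Proof. by move=> /holoP h; have [] := nbhs_singleton h. Qed.

Lemma eqN_eq0 (x : C) : x = - x -> x = 0.
Proof. by move/eqP; rewrite -subr_eq0 opprK -mulr2n mulrn_eq0 => /eqP. Qed.

Section wedge_zero.
Variables (w a : diff_form R n).
Hypothesis hw : holomorphic_form 1 w.
Hypothesis wa : germ_eq (wedge_form w a) (form0 (n := n)).

(** The antiderivation formula, with w /\ a = 0. *)
Lemma coef_mul l : \forall z \near (0 : V), forall I,
  wedge (w z) (ext_contract l (a z)) I = w z [set l]%SET * a z I.
Proof.
move/holoP: hw => hw'; apply: filterS2 hw' wa => z [_ /one_formP w1] wz I.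
rewrite -(contract_wedge l _ _ w1).
have -> : wedge (w z) (a z) = [ffun=> 0] by exact: wz.
have -> : ext_contract l ([ffun=> 0] : ext C n) I = 0.
  by rewrite ffunE; case: ifP => // _; rewrite ffunE mulr0.
by rewrite add0r.
Qed.
End wedge_zero.

(** When a coefficient of w is invertible, contraction followed by division by
    it is a section of the product with w. *)
Lemma division_unit w (k : int) l : holomorphic_form 1 w -> w 0 [set l]%SET != 0 ->
  division_property w k.
Proof.
move=> hw wl a ha wa.
have cm := coef_mul hw wa l.
have wl_near : \forall z \near (0 : V), w z [set l]%SET != 0.
  have cw : {for 0, continuous (fun z : V => w z [set l]%SET : C)}.
    by apply: differentiable_continuous; exact: (smooth0 hw).
  have wp : 0 < nv (w 0 [set l]%SET : C) by rewrite nv_gt0.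
  have [d d0 D] := (contP _ _).1 cw _ wp.
  apply/nearP; exists d; first exact: d0.
  move=> v /D h; apply/eqP => w0; move: h; rewrite w0 sub0r nvN ltxx.
  by [].
exists (fun z => [ffun I : {set 'I_n} => (w z [set l]%SET)^-1 * ext_contract l (a z) I]).
  apply/holoP; move/holoP: ha => ha; move/holoP: hw => hw.
  near=> z; have [dw _] : smooth_at w z /\ of_degree 1 (w z) by near: z.
  have [da ak] : smooth_at a z /\ of_degree k (a z) by near: z.
  have wz : w z [set l]%SET != 0 by near: z.
  split=> I.
    have -> : (fun y => [ffun I : {set 'I_n} => (w y [set l]%SET)^-1 * ext_contract l (a y) I] I : C)
       = (fun y => (w y [set l]%SET)^-1 * ext_contract l (a y) I).
      by apply/funext => y; rewrite ffunE.
    apply: differentiableM; first by apply: differentiableV; [exact: dw|exact: wz].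
    exact: smooth_contract.
  by move=> Ik; rewrite ffunE (contract_degree l ak Ik) mulr0.
apply: filterS2 cm wl_near => z cmz wz; apply/ffunP => I.
by rewrite /wedge_form wedgeZ cmz mulrA mulVf // mul1r.
Unshelve. all: by end_near. Qed.

Lemma division_torsion w a l e : holomorphic_form 1 w -> w 0 [set l]%SET = 0 ->
  'd (fun y => w y [set l]%SET : C) 0 e = 1 ->
  (\forall z \near (0 : V), smooth_at a z) ->
  (\forall z \near (0 : V), forall I, w z [set l]%SET * a z I = 0) ->
  germ_eq a (form0 (n := n)).
Proof.
move=> hw w0 de da wa.
have hA : \forall z \near (0 : V), differentiable (fun y => w y [set l]%SET : C) z.
  by move/holoP: hw; apply: filterS => z [dw _]; exact: dw.
have : \forall z \near (0 : V), forall I : {set 'I_n}, a z I = 0.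
  apply: (@filter_forall _ _ (fun I z => a z I = 0) (nbhs (0 : V)) _) => I.
  apply: (torsion_free hA w0 de (f := fun y => a y I)).
    by apply: filterS da => z dz; exact: dz.
  by apply: filterS wa => z wz; exact: wz.
by apply: filterS => z az; apply/ffunP => I; rewrite az ffunE.
Qed.

Lemma holo_form0 (k : int) : holomorphic_form k (form0 (n := n) : diff_form R n).
Proof.
apply/holoP; near=> z; split=> I; last by move=> _; rewrite ffunE.
have -> : (fun y : V => form0 y I : C) = cst 0 by apply/funext => y; rewrite ffunE.
exact: differentiable_cst.
Unshelve. all: by end_near. Qed.

Lemma division0 w l e : holomorphic_form 1 w -> w 0 [set l]%SET = 0 ->
  'd (fun y => w y [set l]%SET : C) 0 e = 1 -> division_property w 0.
Proof.
move=> hw w0 de a /holoP ha wa; exists (form0 (n := n)); first exact: holo_form0.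
have a0 : germ_eq a (form0 (n := n)).
  apply: (division_torsion hw w0 de); first by apply: filterS ha => z [].
  apply: filterS2 (coef_mul hw wa l) ha => z cm [_ az] I; rewrite -cm.
  by apply: wedge0 => J; exact: (contract_degree l az).
apply: filterS a0 => z ->; apply/ffunP => I.
by rewrite /wedge_form wedge0 ?ffunE // => J; rewrite ffunE.
Qed.

(** Coefficientwise division. The quotient is set to 0 in the other degrees,
    where the germ of g vanishes but the choice of h would be uncontrolled. *)
Lemma divide_form w l e (g : diff_form R n) (k : int) : holomorphic_form 1 w -> w 0 [set l]%SET = 0 ->
  'd (fun y => w y [set l]%SET : C) 0 e = 1 ->
  (\forall z \near (0 : V), smooth_at g z /\ of_degree k (g z)) ->
  (\forall z \near (0 : V), w z [set l]%SET = 0 -> g z = [ffun=> 0]) ->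
  exists2 d, holomorphic_form k d &
    \forall z \near (0 : V), forall I, g z I = w z [set l]%SET * d z I.
Proof.
move=> hw w0 de hg g0.
have hA : \forall z \near (0 : V), differentiable (fun y => w y [set l]%SET : C) z.
  by move/holoP: hw; apply: filterS => z [dw _]; exact: dw.
have /choice[h hP] : forall I, exists h : V -> C,
    (\forall z \near (0 : V), differentiable h z) /\
    (\forall z \near (0 : V), g z I = w z [set l]%SET * h z).
  move=> I; have [h h1 h2] : exists2 h : V -> C, \forall z \near (0 : V), differentiable h z &
      \forall z \near (0 : V), g z I = w z [set l]%SET * h z.
    apply: (division hA w0 de (f := fun y => g y I)).
      by apply: filterS hg => z [dz _]; exact: dz.
    by apply: filterS g0 => z gz wz; rewrite gz // ffunE.
  by exists h.
exists (fun z => [ffun I : {set 'I_n} => if #|I|%:Z == k then h I z else 0]).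
  apply/holoP.
  have : \forall z \near (0 : V), forall I : {set 'I_n}, differentiable (h I) z.
    by apply: (@filter_forall _ _ (fun I z => differentiable (h I) z) (nbhs (0 : V)) _) => I; exact: (proj1 (hP I)).
  apply: filterS => z dh; split=> I; last by move=> Ik; rewrite ffunE (negbTE Ik).
  have [Ik|Ik] := boolP (#|I|%:Z == k).
    have -> : (fun y => [ffun I : {set 'I_n} => if #|I|%:Z == k then h I y else 0] I : C) = h I.
      by apply/funext => y; rewrite ffunE Ik.
    exact: dh.
  have -> : (fun y => [ffun I : {set 'I_n} => if #|I|%:Z == k then h I y else 0] I : C) = cst 0.
    by apply/funext => y; rewrite ffunE (negbTE Ik).
  exact: differentiable_cst.
have hh : \forall z \near (0 : V), forall I : {set 'I_n}, g z I = w z [set l]%SET * h I z.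
  by apply: (@filter_forall _ _ (fun I z => g z I = w z [set l]%SET * h I z) (nbhs (0 : V)) _) => I; exact: (proj2 (hP I)).
apply: filterS2 hg hh => z [_ gk] hz I; rewrite ffunE; case: ifP => Ik; first exact: hz.
by rewrite mulr0 gk // Ik.
Qed.

(** The induction step. The hypothesis is used for the form with coefficients
    w o rho, and its solution for g o rho also serves for g at the points of the
    hypersurface, which rho fixes. *)
Lemma division_step w l e (k : nat) : holomorphic_form 1 w -> w 0 [set l]%SET = 0 ->
  'd (fun y => w y [set l]%SET : C) 0 e = 1 ->
  (forall rho : V -> V, (exists psi : V -> C, [/\ rho = (fun x => x - psi x *: e),
       differentiable psi 0 & psi 0 = 0]) -> holomorphic_form 1 (w \o rho) ->
     division_property (w \o rho) k%:Z) ->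
  division_property w k.+1%:Z.
Proof.
move=> hw w0 de IH a ha wa.
have hA : \forall z \near (0 : V), differentiable (fun y => w y [set l]%SET : C) z.
  by move/holoP: hw; apply: filterS => z [dw _]; exact: dw.
have [psi [dpsi psi0 Apsi psiA]] := retraction hA w0 de.
pose rho (x : V) := x - psi x *: e.
have rho0 : rho 0 = 0 by rewrite /rho psi0 scale0r subr0.
have drho : \forall z \near (0 : V), differentiable rho z.
  apply: filterS dpsi => z dz; apply: differentiableB; first exact: ex_diff.
  exact: (differentiableZl e dz).
have rho_near (P : V -> Prop) : (\forall z \near (0 : V), P z) -> \forall z \near (0 : V), P (rho z).
  move=> HP; have /differentiable_continuous cr := nbhs_singleton drho.
  by apply: cr; rewrite rho0.
pose g z := ext_contract l (a z) : ext C n.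
have cm := coef_mul hw wa l.
have kE : k.+1%:Z - 1 = k%:Z by rewrite -addn1 PoszD addrK.
have hg : \forall z \near (0 : V), smooth_at g z /\ of_degree k%:Z (g z).
  move/holoP: ha; apply: filterS => z [da ak]; split; first exact: smooth_contract.
  by rewrite -kE; exact: (contract_degree l ak).
have comp k' (b : diff_form R n) : (\forall z \near (0 : V), smooth_at b z /\ of_degree k' (b z)) ->
    holomorphic_form k' (b \o rho).
  move=> hb; apply/holoP; apply: filterS2 drho (rho_near _ hb) => z dz [db bk].
  by split; [exact: smooth_comp|exact: bk].
have hwr : holomorphic_form 1 (w \o rho) by apply: comp; move/holoP: hw.
have hgr : holomorphic_form k%:Z (g \o rho) by exact: comp.
have wgr : germ_eq (wedge_form (w \o rho) (g \o rho)) (form0 (n := n)).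
  apply: filterS2 (rho_near _ cm) Apsi => z cmz Az; apply/ffunP => I.
  by rewrite /wedge_form /= cmz -/(rho z) in Az *; rewrite Az mul0r ffunE.
have psi_d : differentiable psi 0 := nbhs_singleton dpsi.
have [b hb gb] := IH rho (ex_intro _ psi (And3 erefl psi_d psi0)) hwr (g \o rho) hgr wgr.
(* The form q is g - w /\ b; the coefficient -1 matches wedge_linear. *)
pose q z : ext C n := [ffun I : {set 'I_n} => g z I + -1 * wedge (w z) (b z) I].
have hq : \forall z \near (0 : V), smooth_at q z /\ of_degree k%:Z (q z).
  move/holoP: hb; move/holoP: hw => hw'.
  apply: filterS3 hg hw' => z [dg gk] [dw w1] [db bk]; split=> I.
    have -> : (fun y => q y I : C) = (fun y => g y I + -1 * wedge_form w b y I).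
      by apply/funext => y; rewrite ffunE.
    apply: differentiableD; first exact: dg.
    by apply: differentiableM; [exact: differentiable_cst|exact: smooth_wedge].
  move=> Ik; rewrite ffunE gk // add0r.
  by rewrite (wedge_degree (one_formP w1) bk Ik) mulr0.
have q0 : \forall z \near (0 : V), w z [set l]%SET = 0 -> q z = [ffun=> 0].
  apply: filterS2 psiA gb => z pz gz Az; apply/ffunP => I; rewrite [LHS]ffunE [RHS]ffunE.
  have rz : rho z = z by rewrite /rho pz // scale0r subr0.
  by move: gz; rewrite /wedge_form /= rz => ->; rewrite mulN1r subrr.
have [d hd qd] := divide_form hw w0 de hq q0.
have hdk : holomorphic_form (k.+1%:Z - 1) d by rewrite kE.
exists d; first exact: hdk.
pose r z : ext C n := [ffun I : {set 'I_n} => a z I + -1 * wedge (w z) (d z) I].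
suff : germ_eq r (form0 (n := n)).
  apply: filterS => z rz; apply/ffunP => I; have := congr1 (fun x : ext C n => x I) rz.
  by rewrite [r z I]ffunE [X in _ = X]ffunE mulN1r => /eqP; rewrite subr_eq0 => /eqP.
apply: (division_torsion hw w0 de).
  move/holoP: ha; move/holoP: hd; move/holoP: hw => hw'.
  apply: filterS3 hw' => z [dw _] [dd _] [da _] I.
  have -> : (fun y => r y I : C) = (fun y => a y I + -1 * wedge_form w d y I).
    by apply/funext => y; rewrite ffunE.
  apply: differentiableD; first exact: da.
  by apply: differentiableM; [exact: differentiable_cst|exact: smooth_wedge].
move/holoP: hw => hw'; apply: filterS3 hw' cm qd => z [_ /one_formP w1] cmz qz I.
rewrite ffunE mulrDr -cmz.
have -> : ext_contract l (a z) =
    [ffun J : {set 'I_n} => wedge (w z) (b z) J + w z [set l]%SET * d z J].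
  apply/ffunP => J; rewrite [RHS]ffunE -qz [q z J]ffunE /g mulN1r addrC subrK.
  by [].
rewrite wedge_linear (eqN_eq0 (wedge_wedgeN (b z) I w1)) add0r.
by rewrite mulN1r mulrN subrr.
Qed.

Lemma division_cases w (k : int) : holomorphic_form 1 w -> (0 < linear_part_rank w)%N ->
  (forall l e, w 0 [set l]%SET = 0 -> 'd (fun y => w y [set l]%SET : C) 0 e = 1 ->
     division_property w k) ->
  division_property w k.
Proof.
move=> hw hr H; have [l [e de]] := rank_gt0_coef (smooth0 hw) hr.
have [w0|w0] := eqVneq (w 0 [set l]%SET) 0; first exact: H w0 de.
exact: division_unit hw w0.
Qed.

Theorem division_of_rank k w : holomorphic_form 1 w -> (k < linear_part_rank w)%N ->
  division_property w k%:Z.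
Proof.
elim: k w => [|k IH] w hw hr.
  by apply: (division_cases hw hr) => l e w0 de; exact: (division0 hw w0 de).
apply: (division_cases hw (leq_ltn_trans (leq0n _) hr)) => l e w0 de.
apply: (division_step hw w0 de) => rho [psi [-> dpsi psi0]] hwr.
apply: IH; first exact: hwr.
rewrite -ltnS; apply: leq_trans hr _.
exact: (rank_retract e (smooth0 hw) dpsi psi0).
Qed.

End Main.

Theorem proposition5p19 (R : realType) (n p : nat) (w : diff_form R n)
    (hw : holomorphic_form 1 w) (hrank : (p.+1 <= linear_part_rank w)%N)
    (k : nat) (hk : (k <= p)%N) :
  division_property w k%:Z.
Proof. exact: (division_of_rank hw (leq_ltn_trans hk hrank)). Qed.
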